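(* In the standing setting described in the context, let $R$ be the global profile (unique up to translation) with sonic crossing point $\xi_s$ described in the context. Define $$U(\xi)=c+\frac{m}{R(\xi)},\quad e(\xi)=e(R(\xi)),\quad S(\xi)=\mathcal S(R(\xi)),\quad \mathcal E(\xi)=R(\xi)e(\xi)+\tfrac12R(\xi)U(\xi)^2.$$ Say that $r$ is in the admissible range if $1\le r<1+\frac2{a_s}$ when $0<a_s<2$, and if $1\le r<\infty$ when $a_s=0$. Then: (i) $(R,U,\mathcal E,S)$ is a weak solution on $\mathbb R$ of the traveling-wave system $$-c\dot R+\tfrac{d}{d\xi}(RU)=0,\qquad -c\tfrac{d}{d\xi}(RU)+\tfrac{d}{d\xi}\big(RU^2+\tilde p(R,e)+S\big)=0,$$ $$-c\dot{\mathcal E}+\tfrac{d}{d\xi}\big((\mathcal E+\tilde p(R,e)+S)U\big)=0,\qquad R^{-1}S-\alpha\tfrac{d}{d\xi}\big(R^{-1}\dot S\big)-2\alpha\dot U^2=0.$$ (ii) $R,U,\mathcal E,e,S$ restrict to $C^2$ functions on $(-\infty,\xi_s)\cup(\xi_s,\infty)$. (iii) Near $\xi_s$, the functions $R,U,\mathcal E,e,S$ are $C^{0,\beta}$ with $\beta=(1+a_s/2)^{-1}$ if $0<a_s<2$, and $C^{0,\beta}$ for every $\beta<1$ if $a_s=0$. (iv) $R,U,\mathcal E,e,S\in L^\infty(\mathbb R)$. Moreover, let $R_{\mathrm{int}}\in C^\infty(\mathbb R)$ take values in $[R_-,R_+]$ with $R_{\mathrm{int}}(\xi)=R_-$ for $\xi\le\xi_s-1$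 and $R_{\mathrm{int}}(\xi)=R_+$ for $\xi\ge\xi_s+1$, and let $U_{\mathrm{int}},\mathcal E_{\mathrm{int}},e_{\mathrm{int}},S_{\mathrm{int}}$ be obtained from $R_{\mathrm{int}}$ by the same formulas as $U,\mathcal E,e,S$ are obtained from $R$. Then $R-R_{\mathrm{int}}$, $U-U_{\mathrm{int}}$, $\mathcal E-\mathcal E_{\mathrm{int}}$, $e-e_{\mathrm{int}}$, $S-S_{\mathrm{int}}$ belong to $L^\mu(\mathbb R)$ for all $\mu\in[1,\infty]$. (v) For every $r$ in the admissible range, $\dot R,\dot U,\dot{\mathcal E},\dot e,\dot S\in L^r(\mathbb R)$. (vi) For every $r$ in the admissible range, $R-R_{\mathrm{int}}$, $U-U_{\mathrm{int}}$, $\mathcal E-\mathcal E_{\mathrm{int}}$, $e-e_{\mathrm{int}}$, $S-S_{\mathrm{int}}$ belong to $W^{1,r}(\mathbb R)$.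
   Context: Standing setting. Fix $\alpha>0$, a physical equation of state $\tilde p:(0,\infty)\times\mathbb R\to\mathbb R$, $(\rho,e)\mapsto\tilde p(\rho,e)$, of class $C^2$, real numbers $c,m,q,k$ with $m\neq0$, and end states $R_\pm>0$, $U_\pm,\mathcal E_\pm\in\mathbb R$. Put $e_\pm=\mathcal E_\pm/R_\pm-\frac12U_\pm^2$ and assume the Rankine–Hugoniot relations $R_\pm(U_\pm-c)=m$, $mU_\pm+\tilde p(R_\pm,e_\pm)=q$, $(\mathcal E_\pm+\tilde p(R_\pm,e_\pm))U_\pm-c\,\mathcal E_\pm=k$. For $R>0$ define $$e(R)=e_0+\frac{A}{R}+\frac{m^2}{2R^2},\quad e_0=\frac{k-qc+\frac m2c^2}{m},\quad A=mc-q,$$ the reduced pressure $p(R)=\tilde p(R,e(R))$, and $\mathcal S(R)=q-mc-\frac{m^2}{R}-p(R)$. (Then $e(R_\pm)=e_\pm$ and $\mathcal S(R_\pm)=0$.) Primes denote $d/dR$, dots denote $d/d\xi$. Assume: (1) $R_-<R_+$; (2) Lax inequalities: $U_--\sqrt{p'(R_-)}>c>U_+-\sqrt{p'(R_+)}$ (with $p'(R_\pm)\ge0$); equivalently $m>0$, $\frac{m^2}{R_-^2}-p'(R_-)>0$ and $\frac{m^2}{R_+^2}-p'(R_+)<0$; (3) $p\in C^2((0,\infty))$, and one of the following convexity criteria holds along $(\rho,e)=(R,e(R))$ for $R\in[R_-,R_+]$: (A) the matrix $\begin{pmatrix}\tilde p_{\rho\rho}+\frac{m^2}{R^4}\tilde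 p_e&\tilde p_{\rho e}-\frac1R\tilde p_e\\ \tilde p_{\rho e}-\frac1R\tilde p_e&\tilde p_{ee}\end{pmatrix}$ is positive semidefinite; or (B) $\tilde p_{\rho\rho}\ge0$, $\tilde p_{ee}\ge0$, $\tilde p_e\ge0$, $\tilde p_{\rho e}\ge\frac1R\tilde p_e$, $e'(R)\ge0$. In particular $p''(R)\ge0$, and this inequality is assumed for all $R>0$; (4) $p''$ is Lipschitz in a neighborhood of $R_s$, where the sonic density $R_s\in(R_-,R_+)$ is the unique zero of $\mathcal S'$ in $(0,\infty)$. Sonic exponent: $a_s=-\frac{2p''(R_s)}{\mathcal S''(R_s)}$; one has $0\le a_s<2$. Canonical one-sided solutions. With $P(R)=-\frac2R-\frac{2p''(R)}{\mathcal S'(R)}$ and $Q(R)=\frac2\alpha\frac{\mathcal S(R)}{\mathcal S'(R)}$, $Z_-$ is the unique function in $C^1((R_-,R_s))\cap C^0([R_-,R_s))$ with $Z_-'+PZ_-=Q$ on $(R_-,R_s)$ and $Z_-(R_-)=0$; $Z_+$ is the unique function in $C^1((R_s,R_+))\cap C^0((R_s,R_+])$ with $Z_+'+PZ_+=Q$ on $(R_s,R_+)$ and $Z_+(R_+)=0$. The global profile $R:\mathbb R\to(R_-,R_+)$ (which exists, uniquely up to translation) is continuous and strictly increasing, with a point $\xi_s$ such that $R(\xi_s)=R_s$, $R$ is $C^2$ on $(-\infty,\xi_s)\cup(\xi_s,\infty)$, $\dot R^2=Z_-(R)$ on $(-\infty,\xi_s)$, $\dot R^2=Z_+(R)$ on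 $(\xi_s,\infty)$, $R(\xi)\to R_\pm$ and $\dot R(\xi)\to0$ as $\xi\to\pm\infty$, and $R\in W^{1,2}_{\mathrm{loc}}(\mathbb R)$ satisfies, for every $\varphi\in C_c^\infty(\mathbb R)$, $\int_{\mathbb R}\alpha\frac{\mathcal S'(R)}{R}\dot R\,\dot\varphi\,d\xi+\int_{\mathbb R}\big(\frac{\mathcal S(R)}{R}-2\alpha\frac{m^2}{R^4}\dot R^2\big)\varphi\,d\xi=0$. Weak solution of the traveling-wave system means that the equations hold in the sense of distributions on $\mathbb R$; the last one means $\int_{\mathbb R}(R^{-1}S-2\alpha\dot U^2)\varphi\,d\xi+\int_{\mathbb R}\alpha R^{-1}\dot S\,\dot\varphi\,d\xi=0$ for all $\varphi\in C_c^\infty(\mathbb R)$. *)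

(* Defs.v *)
From mathcomp Require Import all_boot all_order all_algebra.
From mathcomp Require Import all_classical all_reals all_analysis.

Set Implicit Arguments.
Unset Strict Implicit.
Unset Printing Implicit Defensive.

Import Order.TTheory GRing.Theory Num.Theory.
Import numFieldNormedType.Exports.

Local Open Scope ring_scope.
Local Open Scope classical_set_scope.

(* Meant for open [A]: values of [f] outside [A] are irrelevant. *)
Definition C1_on (R : realType) (A : set R) (f : R -> R) : Prop :=
  forall x, A x -> derivable f x 1 /\ {for x, continuous (derive1 f)}.

Definition C2_on (R : realType) (A : set R) (f : R -> R) : Prop :=
  C1_on A f /\ C1_on A (derive1 f).

Definition smooth (R : realType) (f : R -> R) : Prop :=
  forall (n : nat) (x : R), derivable (derive1n n f) x 1.

Definition Holder_near (R : realType) (b x0 : R) (f : R -> R) : Prop :=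
  exists2 N, nbhs x0 N & exists C, forall x y, N x -> N y ->
    `|f x - f y| <= C * `|x - y| `^ b.

Definition pd1 (R : realType) (f : R -> R -> R) (rho e : R) : R :=
  derive1 (fun s => f s e) rho.

Definition pd2 (R : realType) (f : R -> R -> R) (rho e : R) : R :=
  derive1 (f rho) e.

Definition C0_half_plane (R : realType) (f : R -> R -> R) : Prop :=
  forall z : R * R, 0 < z.1 ->
    {for z, continuous (fun w : R * R => f w.1 w.2)}.

Definition C1_half_plane (R : realType) (f : R -> R -> R) : Prop :=
  [/\ C0_half_plane f,
      forall rho e, 0 < rho -> derivable (fun s => f s e) rho 1,
      forall rho e, 0 < rho -> derivable (f rho) e 1,
      C0_half_plane (pd1 f) & C0_half_plane (pd2 f)].

Definition C2_half_plane (R : realType) (f : R -> R -> R) : Prop :=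
  [/\ C1_half_plane f, C1_half_plane (pd1 f) & C1_half_plane (pd2 f)].

Definition in_Lp (R : realType) (p : \bar R) (f : R -> R) : Prop :=
  f \in Lfun (@lebesgue_measure R) p.

Definition in_Lp_loc (R : realType) (p : \bar R) (f : R -> R) : Prop :=
  forall A : set R, compact A -> in_Lp p (f \_ A).

Definition test_function (R : realType) (phi : R -> R) : Prop :=
  smooth phi /\ compact (closure [set x | phi x != 0]).

(* Action on the test function [phi] of the distributional derivative of the
   locally integrable function [f]. *)
Definition dist_deriv (R : realType) (f phi : R -> R) : R :=
  - \int[@lebesgue_measure R]_x (f x * derive1 phi x).

Definition weak_derivative (R : realType) (f g : R -> R) : Prop :=
  [/\ locally_integrable setT f, locally_integrable setT g &
      forall phi, test_function phi ->
        dist_deriv f phi = \int[@lebesgue_measure R]_x (g x * phi x)].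

Definition in_W1p (R : realType) (p : \bar R) (f : R -> R) : Prop :=
  in_Lp p f /\ exists2 g, weak_derivative f g & in_Lp p g.

Definition in_W1p_loc (R : realType) (p : \bar R) (f : R -> R) : Prop :=
  in_Lp_loc p f /\ exists2 g, weak_derivative f g & in_Lp_loc p g.

(* For functions that are differentiable away from one point: [derive1 f] takes
   an arbitrary value at that point, and is required to represent the
   distributional derivative of [f]. *)
Definition deriv_in_Lp (R : realType) (p : \bar R) (f : R -> R) : Prop :=
  weak_derivative f (derive1 f) /\ in_Lp p (derive1 f).

Definition velocity (R : realType) (c m rho : R) : R := c + m / rho.

Definition internal_energy (R : realType) (c m q k rho : R) : R :=
  let e0 := (k - q * c + m / 2 * c ^+ 2) / m in
  let A := m * c - q in
  e0 + A / rho + m ^+ 2 / (2 * rho ^+ 2).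

Definition total_energy (R : realType) (c m q k rho : R) : R :=
  rho * internal_energy c m q k rho + 2^-1 * rho * velocity c m rho ^+ 2.

Definition pressure (R : realType) (pt : R -> R -> R) (c m q k rho : R) : R :=
  pt rho (internal_energy c m q k rho).

Definition stress (R : realType) (pt : R -> R -> R) (c m q k rho : R) : R :=
  q - m * c - m ^+ 2 / rho - pressure pt c m q k rho.

Definition Rankine_Hugoniot (R : realType) (pt : R -> R -> R)
    (c m q k rho U E : R) : Prop :=
  let e := E / rho - 2^-1 * U ^+ 2 in
  [/\ rho * (U - c) = m,
      m * U + pt rho e = q &
      (E + pt rho e) * U - c * E = k].

Definition positive_semidefinite (R : realType) (n : nat) (M : 'M[R]_n) : Prop :=
  M^T = M /\ forall v : 'cV[R]_n, 0 <= (v^T *m M *m v) ord0 ord0.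

Definition convexity_A (R : realType) (pt : R -> R -> R)
    (c m q k rho : R) : Prop :=
  let e := internal_energy c m q k rho in
  let a := pd1 (pd1 pt) rho e + m ^+ 2 / rho ^+ 4 * pd2 pt rho e in
  let b := pd2 (pd1 pt) rho e - rho^-1 * pd2 pt rho e in
  let d := pd2 (pd2 pt) rho e in
  positive_semidefinite
    (block_mx a%:M b%:M
              b%:M d%:M : 'M[R]_(1 + 1)).

Definition convexity_B (R : realType) (pt : R -> R -> R)
    (c m q k rho : R) : Prop :=
  let e := internal_energy c m q k rho in
  [/\ 0 <= pd1 (pd1 pt) rho e,
      0 <= pd2 (pd2 pt) rho e,
      0 <= pd2 pt rho e,
      rho^-1 * pd2 pt rho e <= pd2 (pd1 pt) rho e &
      0 <= derive1 (internal_energy c m q k) rho].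

Definition sonic_density (R : realType) (pt : R -> R -> R)
    (c m q k Rm Rp Rs : R) : Prop :=
  [/\ Rm < Rs < Rp,
      derive1 (stress pt c m q k) Rs = 0 &
      forall rho, 0 < rho -> derive1 (stress pt c m q k) rho = 0 -> rho = Rs].

Definition sonic_exponent (R : realType) (pt : R -> R -> R)
    (c m q k Rs : R) : R :=
  - (2 * derive1n 2 (pressure pt c m q k) Rs / derive1n 2 (stress pt c m q k) Rs).

Definition Z_ode (R : realType) (pt : R -> R -> R) (alpha c m q k : R)
    (Z : R -> R) (rho : R) : Prop :=
  let p := pressure pt c m q k in
  let S := stress pt c m q k in
  let P := - (2 / rho) - 2 * derive1n 2 p rho / derive1 S rho in
  let Q := 2 / alpha * (S rho / derive1 S rho) in
  derive1 Z rho + P * Z rho = Q.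

Definition canonical_left (R : realType) (pt : R -> R -> R)
    (alpha c m q k Rm Rs : R) (Z : R -> R) : Prop :=
  [/\ C1_on `]Rm, Rs[ Z,
      {within `[Rm, Rs[, continuous Z},
      forall rho, Rm < rho < Rs -> Z_ode pt alpha c m q k Z rho &
      Z Rm = 0].

Definition canonical_right (R : realType) (pt : R -> R -> R)
    (alpha c m q k Rs Rp : R) (Z : R -> R) : Prop :=
  [/\ C1_on `]Rs, Rp[ Z,
      {within `]Rs, Rp], continuous Z},
      forall rho, Rs < rho < Rp -> Z_ode pt alpha c m q k Z rho &
      Z Rp = 0].

(* The a.e. derivative [derive1 Rf] represents the weak derivative of [Rf], since
   [Rf] is continuous, and C^2 away from [xis]. *)
Definition profile_weak_equation (R : realType) (pt : R -> R -> R)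
    (alpha c m q k : R) (Rf : R -> R) : Prop :=
  let S := stress pt c m q k in
  forall phi, test_function phi ->
    \int[@lebesgue_measure R]_x
      (alpha * (derive1 S (Rf x) / Rf x) * derive1 Rf x * derive1 phi x) +
    \int[@lebesgue_measure R]_x
      ((S (Rf x) / Rf x
        - 2 * alpha * (m ^+ 2 / Rf x ^+ 4) * derive1 Rf x ^+ 2) * phi x) = 0.

Definition global_profile (R : realType) (pt : R -> R -> R)
    (alpha c m q k Rm Rp Rs : R) (Zm Zp : R -> R) (xis : R)
    (Rf : R -> R) : Prop :=
  [/\ [/\ forall x, Rm < Rf x < Rp,
          continuous Rf,
          {homo Rf : x y / x < y} &
          Rf xis = Rs],
      [/\ C2_on (`]-oo, xis[ `|` `]xis, +oo[) Rf,
          forall x, x < xis -> derive1 Rf x ^+ 2 = Zm (Rf x) &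
          forall x, xis < x -> derive1 Rf x ^+ 2 = Zp (Rf x)],
      [/\ Rf x @[x --> -oo] --> Rm,
          Rf x @[x --> +oo] --> Rp,
          derive1 Rf x @[x --> -oo] --> 0 &
          derive1 Rf x @[x --> +oo] --> 0],
      in_W1p_loc 2%:E Rf &
      profile_weak_equation pt alpha c m q k Rf].

(* The local integrability requirements give a meaning to the distributions
   (in the library the integral of a non-integrable function is a junk value);
   [derive1 U] and [derive1 S] are a.e. derivatives. *)
Definition weak_solution (R : realType) (pt : R -> R -> R) (alpha c : R)
    (Rf U E e S : R -> R) : Prop :=
  let RU := fun x => Rf x * U x in
  let mom := fun x => Rf x * U x ^+ 2 + pt (Rf x) (e x) + S x in
  let flux := fun x => (E x + pt (Rf x) (e x) + S x) * U x in
  [/\ [/\ locally_integrable setT Rf, locally_integrable setT RU &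
          forall phi, test_function phi ->
            - c * dist_deriv Rf phi + dist_deriv RU phi = 0],
      locally_integrable setT mom /\
          (forall phi, test_function phi ->
            - c * dist_deriv RU phi + dist_deriv mom phi = 0),
      [/\ locally_integrable setT E, locally_integrable setT flux &
          forall phi, test_function phi ->
            - c * dist_deriv E phi + dist_deriv flux phi = 0],
      weak_derivative U (derive1 U) /\ weak_derivative S (derive1 S) &
      [/\ locally_integrable setT (fun x => (Rf x)^-1 * S x),
          locally_integrable setT (fun x => (Rf x)^-1 * derive1 S x),
          locally_integrable setT (fun x => derive1 U x ^+ 2) &
          forall phi, test_function phi ->
            \int[@lebesgue_measure R]_x
              (((Rf x)^-1 * S x - 2 * alpha * derive1 U x ^+ 2) * phi x) +
            \int[@lebesgue_measure R]_x
              (alpha * (Rf x)^-1 * derive1 S x * derive1 phi x) = 0]].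

Definition interpolant (R : realType) (Rm Rp xis : R) (Rint : R -> R) : Prop :=
  [/\ smooth Rint,
      forall x, Rm <= Rint x <= Rp,
      forall x, x <= xis - 1 -> Rint x = Rm &
      forall x, xis + 1 <= x -> Rint x = Rp].

Definition admissible (R : realType) (a r : R) : Prop :=
  (0 < a < 2 /\ 1 <= r < 1 + 2 / a) \/ (a = 0 /\ 1 <= r).

(* Main.v *)
Require Import Defs.
From mathcomp Require Import all_boot all_order all_algebra.
From mathcomp Require Import all_classical all_reals all_analysis.
From mathcomp Require Import measurable_realfun ess_sup_inf.
From mathcomp Require Import ring lra.
Import Order.TTheory GRing.Theory Num.Theory.
Import numFieldNormedType.Exports.
Local Open Scope ring_scope.
Local Open Scope classical_set_scope.

Set Implicit Arguments.
Unset Strict Implicit.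
Unset Printing Implicit Defensive.

(** Let [d = |R - Rs|] be the distance to the sonic density and [Z] one of the
    canonical solutions.  Then [y = Z / R ^ 2], as a function of [d], satisfies
    [y' = - h y - f] with [h, f >= 0], where [h = a_s / d + O(1)] (this uses that
    [p''] is Lipschitz at [Rs]), [f = O(1 / d)], and [f] dominates the distance to
    the end state (by concavity of the stress).  Hence [Z <= C d ^ (-a)] for every
    [a > 0] with [a >= a_s], and [Z] dominates the square of the distance to the
    end state.

    Along the profile [Rdot ^ 2 = Z], so [d ^ (a / 2) Rdot] is bounded:
    [sgn (R - Rs) d ^ (1 + a / 2)] is Lipschitz, which is the Hoelder estimate, and
    [Rdot ^ r] is dominated by the derivative of the bounded increasing function
    [sgn (R - Rs) d ^ (1 - a (r - 1) / 2)], so that [Rdot] is in [L^r].  Moreover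
    the distance to the end state is dominated by [Rdot], which is integrable; this
    replaces the exponential decay at infinity.  All other unknowns are [C^2]
    functions of [R]. *)

(** * Calculus away from one point *)

(** Dividing [Z] by [R ^ 2] cancels the term [- 2 / R] of the coefficient [P]. What remains is
    [h = 2 p'' / |S'|]; as [|S'|] vanishes at [Rs] with slope [- S''(Rs)], its singular part is
    exactly [a_s / d].

    The exponent [a] is kept apart from [a_s] because the source [f = O(1 / d)] is integrated
    against [d ^ a], with primitive [d ^ a / a]: this forces [a > 0]. When [a_s = 0], every small
    [a] is allowed, whence the open conditions on the Hoelder exponent and on [r]. The admissible
    range is the positivity of [1 - a (r - 1) / 2]. Since [a_s < 2], it always contains [r = 2],
    which makes the square of [Udot] integrable in the stress equation.

    The sign of [Z] is not part of the definition of a canonical solution. It is read off the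
    profile, which takes every value between the end states and satisfies [Rdot ^ 2 = Z].

    The obstacle is that [Rdot] may be unbounded at [xis]. The calculus lemmas therefore admit one
    exceptional point, at which the function is only continuous and [derive1] has an arbitrary
    value. *)

Lemma open_setC1 (R : realType) (x0 : R) : open ([set~ x0] : set R).
Proof. exact/closed_openC/accessible_closed_set1/hausdorff_accessible/norm_hausdorff. Qed.

Lemma measurable_off_point (R : realType) (x0 : R) (f : R -> R) :
  (forall x, x != x0 -> {for x, continuous f}) -> measurable_fun setT f.
Proof.
move=> cf; rewrite -(setUv [set x0]); apply/measurable_funU => //.
  exact: measurableC.
split; first exact: measurable_fun_set1.
apply: open_continuous_measurable_fun; first exact: open_setC1.
by move=> x /set_mem /= /eqP xx0; exact: cf.
Qed.

(** When [x0] lies inside the interval, the mean value theorem is applied on each side of it;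
    continuity of [f] at [x0] lets the two increments be added. *)
Lemma MVT_off_point (R : realType) (x0 C a b : R) (f df : R -> R) : a <= b ->
  {within `[a, b], continuous f} ->
  (forall x, a < x < b -> x != x0 -> is_derive x 1 f (df x)) ->
  (forall x, a < x < b -> x != x0 -> `|df x| <= C) ->
  `|f b - f a| <= C * (b - a).
Proof.
move=> ab cf dfE dfC.
have side u v : a <= u -> u <= v -> v <= b -> (v <= x0 \/ x0 <= u) ->
    `|f v - f u| <= C * (v - u).
  move=> au uv vb x0uv; have [->|neuv] := eqVneq u v.
    by rewrite !subrr normr0 mulr0.
  have ltuv : u < v by rewrite lt_neqAle neuv.
  have sub x : x \in `]u, v[%R -> a < x < b /\ x != x0.
    rewrite in_itv/= => /andP[ux xv]; split.
      by rewrite (le_lt_trans au ux) (lt_le_trans xv vb).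
    by case: x0uv => ?; [rewrite lt_eqF// (lt_le_trans xv)|
                         rewrite gt_eqF// (le_lt_trans _ ux)].
  have [|c /sub[cab cx0] ->] := MVT ltuv (fun x xuv => dfE x (sub x xuv).1 (sub x xuv).2).
    apply: continuous_subspaceW cf; apply: subset_itv; rewrite bnd_simp //.
  by rewrite normrM (ger0_norm (_ : 0 <= v - u)) ?subr_ge0// ler_wpM2r ?subr_ge0// dfC.
have [bx0|x0b] := leP b x0; first by apply: side => //; left.
have [ax0|x0a] := leP a x0; last by apply: side => //; right; exact: ltW.
rewrite -(subrKA (f x0)) (_ : b - a = b - x0 + (x0 - a)); last by ring.
rewrite (le_trans (ler_normD _ _))// mulrDr lerD//.
  by apply: side => //; [exact: ltW|right].
by apply: side => //; [exact: ltW|left].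
Qed.

(* [f] may be unbounded near [x0].  The map [x |-> F x - \int_a^x f] is continuous
   on [`[a, b]] and has zero derivative off [x0]. *)
Lemma FTC2_off_point (R : realType) (x0 a b : R) (F f : R -> R) : a < b ->
  {within `[a, b], continuous F} ->
  (forall x, a < x < b -> x != x0 -> is_derive x 1 F (f x)) ->
  (forall x, a < x < b -> x != x0 -> {for x, continuous f}) ->
  (@lebesgue_measure R).-integrable `[a, b] (EFin \o f) ->
  \int[@lebesgue_measure R]_(x in `[a, b]) f x = F b - F a.
Proof.
move=> ab cF dF cf intf.
pose I := fun x => \int[@lebesgue_measure R]_(t in `[a, x]) f t.
pose H := F \- I.
have dH x : a < x < b -> x != x0 -> is_derive x 1 H 0.
  move=> /andP[ax xb] xx0; rewrite -(subrr (f x)).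
  have axb : a < x < b by rewrite ax.
  have [dI If] := continuous_FTC1_closed xb intf ax (cf x axb xx0).
  apply: is_deriveB; first exact: dF.
  by rewrite -If derive1E; exact: derivableP.
have /eqP : H b == H a.
  rewrite -subr_eq0 -normr_le0 -(mul0r (b - a)).
  apply: (@MVT_off_point R x0 0 a b H (fun=> 0) (ltW ab) _ dH) => [|x _ _]; last by rewrite normr0.
  move=> x; apply: cvgB; first exact: cF.
  exact: (parameterized_integral_continuous (ltW ab) intf).
rewrite /H /= {2}/I set_itv1 Rintegral_set1 subr0 => /eqP.
by rewrite subr_eq => /eqP ->; rewrite -/(I b); ring.
Qed.

Lemma is_derive_derive1 (R : realType) (f : R -> R) (x : R) :
  derivable f x 1 -> is_derive x 1 f (derive1 f x).
Proof. by move=> df; rewrite derive1E; exact: derivableP. Qed.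

Lemma is_derive1_eq (R : realType) (f : R -> R) (x d : R) :
  is_derive x 1 f d -> derive1 f x = d.
Proof. by move=> df; rewrite derive1E; exact: derive_val. Qed.

Lemma is_derive1_continuous (R : realType) (f : R -> R) (x d : R) :
  is_derive x 1 f d -> {for x, continuous f}.
Proof. by case=> df _; exact/differentiable_continuous/derivable1_diffP. Qed.

Lemma derivable1_continuous (R : realType) (f : R -> R) (x : R) :
  derivable f x 1 -> {for x, continuous f}.
Proof. by move=> df; exact/differentiable_continuous/derivable1_diffP. Qed.

(** On a compact interval that avoids [x0] the integral of [derive1 F] is an increment of [F], hence
    at most [B + B]. Such intervals exhaust both sides of [x0], and monotone convergence applies
    because the integrand is nonnegative there. *)
Lemma integrable_monotone_derivative (R : realType) (x0 B : R) (F : R -> R) :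
  continuous F -> C1_on [set~ x0] F ->
  (forall x, x != x0 -> 0 <= derive1 F x) -> (forall x, `|F x| <= B) ->
  (@lebesgue_measure R).-integrable setT (EFin \o derive1 F).
Proof.
move=> cF C1F F'ge0 FB.
have cF' x : x != x0 -> {for x, continuous (derive1 F)} by move=> /eqP/C1F[].
have dF x : x != x0 -> derivable F x 1 by move=> /eqP/C1F[].
have mF' : measurable_fun setT (derive1 F) := measurable_off_point cF'.
have bnd (D : nat -> set R) :
    {homo D : n m / (n <= m)%N >-> (n <= m)%O} ->
    (forall n, exists2 ab, D n = `[ab.1, ab.2] & ab.1 <= ab.2 /\ (ab.2 < x0 \/ x0 < ab.1)) ->
    (\int[@lebesgue_measure R]_(x in \bigcup_n D n) (derive1 F x)%:E <= (B + B)%:E)%E.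
  move=> homoD Ditv.
  have Dneq n x : D n x -> x != x0.
    have [ab -> [_]] := Ditv n; rewrite /= in_itv/= => abx0 /andP[ax xb].
    by case: abx0 => h; [rewrite lt_eqF// (le_lt_trans xb)|rewrite gt_eqF// (lt_le_trans h)].
  have cvgD : (\int[@lebesgue_measure R]_(x in D n) (derive1 F x)%:E)%E @[n --> \oo] -->
      (\int[@lebesgue_measure R]_(x in \bigcup_n D n) (derive1 F x)%:E)%E.
    apply: ge0_nondecreasing_set_cvg_integral => [//|n|n|n x Dx].
    - by have [ab -> _] := Ditv n; exact: measurable_itv.
    - by apply: measurable_funTS; exact/measurable_EFinP.
    - by rewrite lee_fin F'ge0// (Dneq n).
  apply: (cvge_to_le cvgD).
  apply: nearW => n; have [[a b] /= Dn [ab abx0]] := Ditv n.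
  have [aeb|neab] := eqVneq a b.
    rewrite Dn aeb set_itv1 integral_set1 lee_fin addr_ge0//;
    exact: (le_trans _ (FB x0)).
  have ltab : a < b by rewrite lt_neqAle neab.
  have abneq x : a <= x <= b -> x != x0.
    by move=> xab; apply: (Dneq n); rewrite Dn /= in_itv.
  rewrite Dn (@continuous_FTC2 _ _ F)//.
  - rewrite -EFinB lee_fin lerD//; first exact: le_trans (ler_norm _) (FB _).
    by rewrite (le_trans _ (FB a))// -normrN ler_norm.
  - move=> x; apply: (@continuous_in_subspaceT _ _ `[a, b]) => y /set_mem/=.
    by rewrite in_itv/= => /abneq /cF'.
  - split; [|exact/cvg_at_right_filter/cF|exact/cvg_at_left_filter/cF].
    move=> x; rewrite in_itv/= => /andP[/ltW ax /ltW xb].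
    by apply: dF; apply: abneq; rewrite ax.
(* [E n] and [E' n] increase to the two open half-lines. For [n = 0] they are single points, which
   is why [bnd] admits [ab.1 = ab.2]. *)
pose E n : set R := `[x0 - n.+1%:R, x0 - n.+1%:R^-1].
pose E' n : set R := `[x0 + n.+1%:R^-1, x0 + n.+1%:R].
have inv_le n : n.+1%:R^-1 <= n.+1%:R :> R.
  by rewrite (@le_trans _ _ 1)// ?invf_le1 ?ler1n// ltr0n.
have inv_mono n k : (n <= k)%N -> k.+1%:R^-1 <= n.+1%:R^-1 :> R.
  by move=> nk; rewrite lef_pV2 ?posrE ?ltr0n// ler_nat.
have bE : (\int[@lebesgue_measure R]_(x in \bigcup_n E n) (derive1 F x)%:E <= (B + B)%:E)%E.
  apply: bnd => [n k nk|n].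
    apply/subsetPset/subset_itv; rewrite bnd_simp lerD2l lerN2 ?inv_mono//.
    by rewrite ler_nat ltnS.
  exists (x0 - n.+1%:R, x0 - n.+1%:R^-1) => //=; split; first by rewrite lerD2l lerN2.
  by left; rewrite ltrBlDr ltrDl invr_gt0 ltr0n.
have bE' : (\int[@lebesgue_measure R]_(x in \bigcup_n E' n) (derive1 F x)%:E <= (B + B)%:E)%E.
  apply: bnd => [n k nk|n].
    apply/subsetPset/subset_itv; rewrite bnd_simp lerD2l ?inv_mono//.
    by rewrite ler_nat ltnS.
  exists (x0 + n.+1%:R^-1, x0 + n.+1%:R) => //=; split; first by rewrite lerD2l.
  by right; rewrite ltrDl invr_gt0 ltr0n.
have exn (d : R) : 0 < d -> exists n, n.+1%:R^-1 <= d <= n.+1%:R.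
  move=> d0; exists (maxn (Num.truncn d^-1) (Num.truncn d)); apply/andP; split.
    rewrite invf_ple ?posrE ?ltr0n//; apply/ltW/(lt_le_trans (truncnS_gt _)).
    by rewrite ler_nat ltnS leq_maxl.
  apply/ltW/(lt_le_trans (truncnS_gt _)).
  by rewrite ler_nat ltnS leq_maxr.
have UE : setT `\` [set x0] = (\bigcup_n E n) `|` (\bigcup_n E' n).
  apply/seteqP; split => x /=.
    move=> [_ /eqP xx0]; have [xlt|xgt|xe] := ltgtP x x0.
    - left; have [|n /andP[n1 n2]] := exn (x0 - x); first by rewrite subr_gt0.
      by exists n => //; rewrite /E /= in_itv/= lerBlDr -lerBlDl n2 lerBrDl -lerBrDr n1.
    - right; have [|n /andP[n1 n2]] := exn (x - x0); first by rewrite subr_gt0.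
      by exists n => //; rewrite /E' /= in_itv/= -lerBrDl n1 -lerBlDl.
    - by rewrite xe eqxx in xx0.
  move=> [] [n _]; rewrite /E /E' /= in_itv/= => /andP[n1 n2]; split => // xe.
    by move: n2; rewrite xe lerBrDr gerDl leNgt invr_gt0 ltr0n.
  by move: n1; rewrite xe gerDl leNgt invr_gt0 ltr0n.
apply/integrableP; split; first exact/measurable_EFinP.
rewrite -(@integral_setD1 _ _ x0); last 2 first.
- by apply: measurableD => //; exact: measurable_set1.
- by apply: measurable_funTS; apply: measurableT_comp => //; exact/measurable_EFinP.
have mE : measurable (\bigcup_n E n) by apply: bigcupT_measurable => n; exact: measurable_itv.
have mE' : measurable (\bigcup_n E' n) by apply: bigcupT_measurable => n; exact: measurable_itv.
under eq_integral => x.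
  move=> /set_mem/= -[_ /eqP xx0].
  rewrite /= ger0_norm ?F'ge0//.
  over.
rewrite UE integral_setU//.
- by apply: le_lt_trans (leeD bE bE') _; rewrite -EFinD ltry.
- by apply: measurable_funTS; exact/measurable_EFinP.
- apply/disj_setPS => x [[n _ En] [k _ E'k]].
  move: En E'k; rewrite /E /E' /= !in_itv/= => /andP[_ n1] /andP[k1 _].
  have := le_trans k1 n1; rewrite lerD2l lerNr leNgt; apply/negP/negPn.
  by rewrite (@lt_le_trans _ _ 0) ?oppr_lt0 ?invr_gt0 ?ltr0n// invr_ge0 ler0n.
Qed.

(** * Integrability, membership in L^p and weak derivatives *)

Lemma measurable_normr_powR (R : realType) (r : R) (h : R -> R) :
  measurable_fun setT h -> measurable_fun setT (fun x => `|h x| `^ r).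
Proof.
move=> mh; apply: (measurableT_comp (measurable_powR r)).
exact: measurableT_comp.
Qed.

(** Domination is asked only off [x0], a null set, because this is applied to functions built from
    [derive1], whose value at the sonic crossing is arbitrary. *)
Lemma le_integrable_off_point (R : realType) (x0 : R) (f g : R -> R) :
  measurable_fun setT f -> (forall x, x != x0 -> `|f x| <= g x) ->
  (@lebesgue_measure R).-integrable setT (EFin \o g) ->
  (@lebesgue_measure R).-integrable setT (EFin \o f).
Proof.
move=> mf fg intg; have /integrableP[mg gy] := intg.
apply/integrableP; split; first exact/measurable_EFinP.
apply: le_lt_trans gy.
have mT : measurable (setT `\ x0) by apply: measurableD => //; exact: measurable_set1.
rewrite -(@integral_setD1 _ _ x0 setT)//; last first.
  by apply: measurable_funTS; apply: measurableT_comp => //; exact/measurable_EFinP.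
rewrite -(@integral_setD1 _ _ x0 setT)//; last first.
  by apply: measurable_funTS; apply: measurableT_comp.
apply: ge0_le_integral => //.
- by apply: measurable_funTS; apply: measurableT_comp => //; exact/measurable_EFinP.
- by apply: measurable_funTS; apply: measurableT_comp.
- by move=> x [_ /eqP xx0] /=; rewrite lee_fin (le_trans (fg x xx0))// ler_norm.
Qed.

Lemma in_Lp_powR (R : realType) (r : R) (h : R -> R) :
  measurable_fun setT h ->
  (@lebesgue_measure R).-integrable setT (fun x => (`|h x| `^ r)%:E) ->
  in_Lp r%:E h.
Proof.
move=> mh /integrableP[_ hy]; apply/andP; split; rewrite inE//= /finite_norm unlock.
apply: poweR_lty; apply: le_lt_trans hy.
by under [leRHS]eq_integral => x _ do rewrite gee0_abs ?lee_fin ?powR_ge0//.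
Qed.

Lemma in_Loo_bounded (R : realType) (B : R) (h : R -> R) :
  measurable_fun setT h -> (forall x, `|h x| <= B) -> in_Lp +oo h.
Proof.
move=> mh hB; apply/andP; split; rewrite inE//= /finite_norm unlock.
case: ifP => // _; apply: (@le_lt_trans _ _ B%:E); last exact: ltry.
rewrite (_ : abse \o _ = EFin \o (fun x => `|h x|))//.
by apply: ess_sup_ler => x; rewrite lee_fin; exact: hB.
Qed.

(** Interpolation between L^1 and L^oo: [|h| ^ r <= B ^ (r - 1) * |h|]. *)
Lemma in_Lp_bounded_integrable (R : realType) (B : R) (h : R -> R) (p : \bar R) :
  (@lebesgue_measure R).-integrable setT (EFin \o h) -> (forall x, `|h x| <= B) ->
  (1 <= p)%E -> in_Lp p h.
Proof.
move=> inth hB; have mh : measurable_fun setT h.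
  by have /measurable_int/measurable_EFinP := inth.
case: p => [r|_|//]; last exact: in_Loo_bounded hB.
rewrite lee_fin => r1; apply: in_Lp_powR => //.
have B0 : 0 <= B by exact: le_trans (hB 0).
apply: (@le_integrable_off_point _ 0 _ (fun x => B `^ (r - 1) * `|h x|)).
- exact: measurable_normr_powR.
- move=> x _; rewrite ger0_norm ?powR_ge0//.
  rewrite -mulr_powRB1// ?(lt_le_trans ltr01 r1)// mulrC.
  by rewrite ler_wpM2r// ge0_ler_powR ?subr_ge0 ?nnegrE.
- have := integrableZl measurableT (B `^ (r - 1)) (integrable_norm inth).
  by apply: eq_integrable.
Qed.

Lemma continuous_locally_integrable (R : realType) (f : R -> R) :
  continuous f -> locally_integrable setT f.
Proof.
move=> cf; split; [exact: continuous_measurable_fun|exact: openT|].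
move=> K _ cK; have /integrableP[_] : (@lebesgue_measure R).-integrable K (EFin \o f).
  by apply: continuous_compact_integrable => //; exact: continuous_subspaceT.
by [].
Qed.

Lemma test_function_bounded_support (R : realType) (phi : R -> R) :
  test_function phi -> exists2 M : R, 0 < M &
    forall x, M < `|x| -> phi x = 0 /\ derive1 phi x = 0.
Proof.
move=> [_ /compact_bounded[N [_ /(_ (N + 1))]]].
rewrite ltrDl ltr01 => /(_ isT) suppM; set M := N + 1 in suppM.
have phi0 x : Num.max M 1 < `|x| -> phi x = 0.
  move=> Mx; apply/eqP; apply: contraTT Mx => px; rewrite -leNgt le_max.
  by rewrite suppM//; exact: subset_closure.
exists (Num.max M 1); first by rewrite lt_max ltr01 orbT.
move=> x Mx; split; first exact: phi0.
rewrite derive1E -(derive_cst (0 : R) x 1); apply: near_eq_derive.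
have cn : (fun y : R => `|y|) y @[y --> x] --> `|x| by exact: norm_continuous.
near=> y; rewrite phi0//=; near: y; exact: (cvgr_gt _ cn _ Mx).
Unshelve. all: by end_near. Qed.

(** Integration by parts, by [FTC2_off_point] applied to [f * phi]. This product is continuous at
    [x0], so the exceptional point contributes no jump term. *)
Lemma weak_derivative_off_point (R : realType) (x0 : R) (f f1 : R -> R) :
  continuous f -> (forall x, x != x0 -> is_derive x 1 f (f1 x)) ->
  (forall x, x != x0 -> {for x, continuous f1}) -> locally_integrable setT f1 ->
  weak_derivative f f1.
Proof.
move=> cf df cf1 lf'; split => //; first exact: continuous_locally_integrable.
move=> phi tphi; have [smphi _] := tphi.
have dphi x : derivable phi x 1 by exact: (smphi 0%N).
have dphi' x : derivable (derive1 phi) x 1 by exact: (smphi 1%N).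
have cphi : continuous phi by move=> x; exact: derivable1_continuous.
have cphi' : continuous (derive1 phi) by move=> x; exact: derivable1_continuous.
have [M M0 phi0] := test_function_bounded_support tphi.
have out (g : R -> R) (h : R -> R) : (forall x, M < `|x| -> h x = 0) ->
    \int[@lebesgue_measure R]_x (g x * h x) =
    \int[@lebesgue_measure R]_(x in `[- (M + 1), M + 1]) (g x * h x).
  move=> h0; rewrite [RHS]Rintegral_mkcond; congr Rintegral.
  apply/funext => x; rewrite patchE; case: ifPn => // /negP xM.
  rewrite h0 ?mulr0//; rewrite ltNge; apply/negP => xleM; apply: xM; apply/mem_set.
  rewrite /= in_itv/= -ler_norml (le_trans xleM)// lerDl ler01//.
rewrite /dist_deriv (out f)//; last by move=> x /phi0[].
rewrite (out f1)//; last by move=> x /phi0[].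
(* The endpoints lie strictly beyond [M] because [phi] is only known to vanish where [M < |x|], and
   the boundary terms at [a] and [b] must be zero. *)
set a := - (M + 1); set b := M + 1.
have ab : a < b by rewrite /a /b; lra.
have intf' : (@lebesgue_measure R).-integrable `[a, b] (EFin \o f1).
  have [mf' _ f'y] := lf'; apply/integrableP; split.
    by apply: measurable_funTS; exact/measurable_EFinP.
  by apply: f'y => //; exact: segment_compact.
have i1 : (@lebesgue_measure R).-integrable `[a, b] (EFin \o (fun x => f x * derive1 phi x)).
  apply: continuous_compact_integrable; first exact: segment_compact.
  by apply: continuous_subspaceT => x; apply: continuousM; [exact: cf|exact: cphi'].
have i2 : (@lebesgue_measure R).-integrable `[a, b] (EFin \o (fun x => f1 x * phi x)).
  suff h : (@lebesgue_measure R).-integrable `[a, b] ((EFin \o f1) \* (EFin \o phi))%E by exact: h.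
  apply: integrableMl => //.
    by apply: measurable_funTS; exact: continuous_measurable_fun.
  have /compact_bounded[N [Nreal NP]] : compact (phi @` `[a, b]).
    apply: continuous_compact; last exact: segment_compact.
    exact: continuous_subspaceT.
  by exists N; split => // K NK x xab; apply: NP NK _ _; exists x.
have phib : phi b = 0.
  by case: (phi0 b) => //; rewrite ger0_norm; rewrite /b; lra.
have phia : phi a = 0.
  by case: (phi0 a) => //; rewrite ler0_norm; rewrite /a; lra.
have := @FTC2_off_point R x0 a b (f * phi) (fun x => f x * derive1 phi x + f1 x * phi x) ab.
rewrite RintegralD// !fctE phia phib !mulr0 subrr => H.
apply/eqP; rewrite eq_sym -subr_eq0 opprK addrC; apply/eqP; apply: H.
- by apply: continuous_subspaceT => x; apply: continuousM; [exact: cf|exact: cphi].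
- move=> x _ /df dfx.
  have := is_deriveM dfx (is_derive_derive1 (dphi x)).
  by rewrite /GRing.scale/= (mulrC (phi x)).
- move=> x _ xx0.
  apply: continuousD.
    by apply: continuousM; [exact: cf|exact: cphi'].
  by apply: continuousM; [exact: cf1|exact: cphi].
- exact: (integrableD _ i1 i2).
Qed.

(** * The canonical solutions near the sonic density *)

Lemma is_derive_powR (R : realType) (a x : R) : 0 < x ->
  is_derive x 1 (fun y : R => y `^ a) (a * x `^ (a - 1)).
Proof.
move=> x0; have x0' : x \in `]0, +oo[%R by rewrite in_itv/= x0.
rewrite -(powR_derive1 a x0'); apply: is_derive_derive1; exact: derivable_powR.
Qed.

Lemma is_derive_ge0_le (R : realType) (f df : R -> R) (u w : R) : u <= w ->
  {within `[u, w], continuous f} ->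
  (forall x, u < x < w -> is_derive x 1 f (df x)) ->
  (forall x, u < x < w -> 0 <= df x) -> f u <= f w.
Proof.
rewrite le_eqVlt => /predU1P[->//|uw] cf dfE df0.
have dfE' x : x \in `]u, w[%R -> is_derive x 1 f (df x) by rewrite in_itv/= => /dfE.
have [z zuw fE] := MVT uw dfE' cf.
by rewrite -subr_ge0 fE mulr_ge0 ?subr_ge0 ?(ltW uw) ?df0//; rewrite in_itv in zuw.
Qed.

Lemma is_derive_le0_ge (R : realType) (f df : R -> R) (u w : R) : u <= w ->
  {within `[u, w], continuous f} ->
  (forall x, u < x < w -> is_derive x 1 f (df x)) ->
  (forall x, u < x < w -> df x <= 0) -> f w <= f u.
Proof.
move=> uw cf dfE df0; rewrite -lerN2.
apply: (@is_derive_ge0_le R (fun x => - f x) (fun x => - df x)) => //.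
- by move=> x; apply: cvgN; exact: cf.
- by move=> x /dfE dfx; exact: is_deriveN.
- by move=> x /df0; rewrite oppr_ge0.
Qed.

Lemma is_derive_within_continuous (R : realType) (f df : R -> R) (u w : R) :
  (forall x, u <= x <= w -> is_derive x 1 f (df x)) -> {within `[u, w], continuous f}.
Proof.
move=> dfE x; apply: (@continuous_in_subspaceT _ _ `[u, w]) => t /set_mem/=.
by rewrite in_itv/= => /dfE; exact: is_derive1_continuous.
Qed.

Lemma is_derive_ge0_le_cc (R : realType) (f df : R -> R) (u w : R) : u <= w ->
  (forall x, u <= x <= w -> is_derive x 1 f (df x)) ->
  (forall x, u < x < w -> 0 <= df x) -> f u <= f w.
Proof.
move=> uw dfE; apply: is_derive_ge0_le => //.
  exact: is_derive_within_continuous dfE.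
by move=> x /andP[ux xw]; apply: dfE; rewrite !ltW.
Qed.

Lemma is_derive_le0_ge_cc (R : realType) (f df : R -> R) (u w : R) : u <= w ->
  (forall x, u <= x <= w -> is_derive x 1 f (df x)) ->
  (forall x, u < x < w -> df x <= 0) -> f w <= f u.
Proof.
move=> uw dfE; apply: is_derive_le0_ge => //.
  exact: is_derive_within_continuous dfE.
by move=> x /andP[ux xw]; apply: dfE; rewrite !ltW.
Qed.

Lemma is_derive_subl (R : realType) (L x : R) : is_derive x 1 (fun t : R => L - t) (-1).
Proof. by apply: (is_derive_eq (is_deriveB _ _)); rewrite sub0r. Qed.

Lemma is_derive_subl_sqr (R : realType) (L x : R) :
  is_derive x 1 (fun t : R => (L - t) ^+ 2) (- (2 * (L - x))).
Proof.
apply: (is_derive_eq (is_deriveM (is_derive_subl L x) (is_derive_subl L x))).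
by rewrite /GRing.scale/=; ring.
Qed.

(* The map [d |-> y d - c / 2 * (L - d) ^+ 2] is nonincreasing. *)
Lemma ode_lower (R : realType) (L c : R) (y h f : R -> R) :
  {within `]0, L], continuous y} -> y L = 0 ->
  (forall d : R, 0 < d < L -> is_derive d 1 y (- (h d * y d) - f d)) ->
  (forall d : R, 0 < d < L -> [/\ 0 <= h d, 0 <= y d & c * (L - d) <= f d]) ->
  forall d : R, 0 < d < L -> c / 2 * (L - d) ^+ 2 <= y d.
Proof.
move=> cy yL dy hyf d /andP[d0 dL].
rewrite -subr_ge0; pose w x := y x - c / 2 * (L - x) ^+ 2.
have -> : 0 = w L by rewrite /w yL subrr expr0n mulr0 subr0.
apply: (@is_derive_le0_ge R w (fun x => - (h x * y x) - f x + c * (L - x)) _ _ (ltW dL)).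
- have cy' : {within `[d, L], continuous y}.
    by apply: continuous_subspaceW cy; apply: subset_itv; rewrite bnd_simp.
  move=> x; apply: cvgB; first exact: cy'.
  apply: cvgM; first exact: cvg_cst.
  apply: (@continuous_subspaceT _ _ `[d, L] (fun t : R => (L - t) ^+ 2)) => t.
  exact: is_derive1_continuous (is_derive_subl_sqr L t).
- move=> x /andP[dx xL]; have x0L : 0 < x < L by rewrite (lt_trans d0 dx).
  have dw := is_deriveB (dy x x0L) (is_deriveZ (c / 2) (is_derive_subl_sqr L x)).
  apply: (is_derive_eq dw); rewrite /GRing.scale/=; by field.
- move=> x /andP[dx xL]; have x0L : 0 < x < L by rewrite (lt_trans d0 dx).
  have [hx yx fx] := hyf x x0L.
  have := mulr_ge0 hx yx; lra.
Qed.

(* With [v d = d `^ a * y d], the bounds on [h] and [f] give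
   [v' >= - K v - M d `^ (a - 1)], so that
   [expR (K * d) * v d + M' / a * d `^ a] is nondecreasing near [0]. *)
Lemma ode_upper (R : realType) (L delta a K M : R) (y h f : R -> R) :
  0 < delta < L -> 0 < a -> 0 <= K -> 0 <= M ->
  (forall d : R, 0 < d < L -> is_derive d 1 y (- (h d * y d) - f d)) ->
  (forall d : R, 0 < d < L -> [/\ 0 <= h d, 0 <= y d & 0 <= f d]) ->
  (forall d : R, 0 < d < delta -> h d <= a / d + K /\ f d <= M / d) ->
  exists C : R, forall d : R, 0 < d < L -> d `^ a * y d <= C.
Proof.
move=> /andP[de0 deL] a0 K0 M0 dy hyf hf.
(* [M'] dominates [expR (K * x) * M] on the whole of []0, delta[]. In the script [v] denotes the
   full monotone quantity; [M' / a * x ^ a] is the primitive of [M' * x ^ (a - 1)]. *)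
pose M' := expR (K * delta) * M.
pose v x := expR (K * x) * (x `^ a * y x) + M' / a * x `^ a.
pose dv x := K * expR (K * x) * (x `^ a * y x)
  + expR (K * x) * (a * x `^ (a - 1) * y x + x `^ a * (- (h x * y x) - f x))
  + M' * x `^ (a - 1).
have dvE x : 0 < x < L -> is_derive x 1 v (dv x).
  move=> x0L; have /andP[x0 xL] := x0L.
  have dl : is_derive x 1 (fun t : R => K * t) (K *: 1) by exact: is_deriveZ.
  have de := is_derive1_comp (is_derive_expR (K * x)) dl.
  have dp := is_derive_powR a x0.
  have dd := is_deriveD (is_deriveM de (is_deriveM dp (dy x x0L))) (is_deriveZ (M' / a) dp).
  apply: (is_derive_eq dd); rewrite /dv /GRing.scale !fctE/=.
  by field; lra.
have dv0 x : 0 < x < delta -> 0 <= dv x.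
  move=> /andP[x0 xde]; have x0L : 0 < x < L by rewrite x0 (lt_trans xde).
  have [hx yx fx] := hyf x x0L.
  have [hle fle] := hf x (introT andP (conj x0 xde)).
  have pE : x `^ a = x * x `^ (a - 1) by rewrite mulr_powRB1// ltW.
  have p0 : 0 <= x `^ (a - 1) by exact: powR_ge0.
  have e0 : 0 <= expR (K * x) by exact: expR_ge0.
  have eM : expR (K * x) * M <= M'.
    by rewrite /M' ler_wpM2r// ler_expR ler_wpM2l// ltW.
  have xh : x * h x <= a + K * x.
    rewrite (_ : a + K * x = x * (a / x + K)) ?ler_pM2l//; by field; rewrite gt_eqF.
  have xf : x * f x <= M.
    rewrite (_ : M = x * (M / x)) ?ler_pM2l//; by field; rewrite gt_eqF.
  (* After [x ^ (a - 1)] is factored out, the three terms are nonnegative by the bound on [h], the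
     bound on [f] and the choice of [M'], in this order. *)
  rewrite (_ : dv x = x `^ (a - 1) * (expR (K * x) * (y x * (a + K * x - x * h x))
    + expR (K * x) * (M - x * f x) + (M' - expR (K * x) * M))); last first.
    by rewrite /dv pE; ring.
  apply: mulr_ge0 => //; apply: addr_ge0; last by rewrite subr_ge0.
  apply: addr_ge0; apply: mulr_ge0 => //; last by rewrite subr_ge0.
  by apply: mulr_ge0 => //; rewrite subr_ge0.
have mono u : 0 < u -> u <= delta -> v u <= v delta.
  move=> u0 ude; apply: (@is_derive_ge0_le_cc _ _ dv) => // x /andP[ux xw].
    by apply: dvE; rewrite (lt_le_trans u0)//= (le_lt_trans xw).
  by apply: dv0; rewrite (lt_trans u0).
have y_le w : delta <= w -> w < L -> y w <= y delta.
  move=> dew wL.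
  apply: (@is_derive_le0_ge_cc _ _ (fun x => - (h x * y x) - f x)) => // x /andP[ux xw].
    by apply: dy; rewrite (lt_le_trans de0)//= (le_lt_trans xw).
  have [hx yx fx] := hyf x (introT andP (conj (lt_trans de0 ux) (lt_trans xw wL))).
  have := mulr_ge0 hx yx; lra.
(* The monotone quantity controls [d <= delta]. Beyond [delta], [y] is nonincreasing because [h],
   [y] and [f] are nonnegative, and [d ^ a <= L ^ a]. *)
exists (Num.max (v delta) (L `^ a * y delta)) => d /andP[d0 dL].
have [_ yd _] := hyf d (introT andP (conj d0 dL)).
rewrite le_max; apply/orP; have [dde|ded] := leP d delta.
  left; apply: le_trans (mono d d0 dde).
  rewrite /v ler_wpDr ?mulr_ge0 ?powR_ge0 ?invr_ge0 ?(ltW a0) ?expR_ge0//.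
  by rewrite ler_peMl ?mulr_ge0 ?powR_ge0// -expR0 ler_expR mulr_ge0// ltW.
right; apply: ler_pM => //; first exact: powR_ge0.
  by rewrite ge0_ler_powR ?nnegrE ?ltW// (lt_trans d0).
by apply: y_le => //; exact: ltW.
Qed.

(** The difference factors as [(v - u) * (n * w)] with [n, w >= 0], so the one-sided bound
    [v - u <= z] suffices. This serves both sides of the sonic density, where [v - u] is [z] or
    [- z]. *)
Lemma inv_cube_sub_le (R : realType) (b B u v z : R) :
  0 < b -> b <= u -> u <= B -> b <= v -> v <= B -> 0 <= z -> v - u <= z ->
  (u ^+ 3)^-1 - (v ^+ 3)^-1 <= 3 * B ^+ 2 / b ^+ 6 * z.
Proof.
move=> b0 bu uB bv vB z0 vuz.
have u0 : 0 < u by exact: lt_le_trans bu.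
have v0 : 0 < v by exact: lt_le_trans bv.
have [b0' u0' v0'] : [/\ 0 <= b, 0 <= u & 0 <= v] by split; exact: ltW.
have B0' : 0 <= B by exact: le_trans uB.
pose n := v ^+ 2 + v * u + u ^+ 2.
have n0 : 0 <= n by rewrite !addr_ge0 ?sqr_ge0// mulr_ge0.
have nB : n <= 3 * B ^+ 2.
  rewrite (_ : 3 * B ^+ 2 = B ^+ 2 + B * B + B ^+ 2); last by ring.
  by rewrite /n !lerD ?ler_pM ?lerXn2r ?nnegrE.
pose w := (u ^+ 3 * v ^+ 3)^-1.
have w0 : 0 <= w by rewrite invr_ge0 mulr_ge0 ?exprn_ge0.
have wB : w <= (b ^+ 6)^-1.
  rewrite lef_pV2 ?posrE ?mulr_gt0 ?exprn_gt0// (_ : b ^+ 6 = b ^+ 3 * b ^+ 3); last by ring.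
  by rewrite ler_pM ?exprn_ge0// lerXn2r ?nnegrE.
have -> : (u ^+ 3)^-1 - (v ^+ 3)^-1 = (v - u) * (n * w).
  by rewrite /n /w; field; rewrite !gt_eqF.
rewrite (mulrC _ z); apply: (@le_trans _ _ (z * (n * w))).
  by apply: ler_wpM2r => //; exact: mulr_ge0.
by apply: ler_wpM2l => //; exact: ler_pM.
Qed.

(* [s] is the side of the sonic density [Rs] and [d] the distance to it; the
   function [d |-> Z (Rs + s * d) / (Rs + s * d) ^+ 2] solves the equation of
   [ode_lower] and [ode_upper] with [h = 2 p2 / T], [T = - s * S1]. *)
Lemma one_sided_bounds (R : realType) (s L b B Rs al m a delta Lip : R)
    (p2 S S1 Z : R -> R) :
  s ^+ 2 = 1 -> 0 < delta < L -> 0 < b -> 0 < al -> m != 0 -> 0 <= Lip ->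
  (forall d : R, 0 <= d <= L -> b <= Rs + s * d <= B) ->
  (forall r : R, 0 < r -> is_derive r 1 S (S1 r)) ->
  (forall r : R, 0 < r -> is_derive r 1 S1 (- (2 * m ^+ 2 / r ^+ 3 + p2 r))) ->
  (forall r : R, 0 < r -> 0 <= p2 r) ->
  S1 Rs = 0 -> S (Rs + s * L) = 0 ->
  (forall d : R, 0 < d < L -> is_derive (Rs + s * d) 1 Z
    (2 / al * (S (Rs + s * d) / S1 (Rs + s * d))
     - (- (2 / (Rs + s * d)) - 2 * p2 (Rs + s * d) / S1 (Rs + s * d)) * Z (Rs + s * d))) ->
  (forall d : R, 0 < d < L -> 0 <= Z (Rs + s * d)) ->
  {within `]0, L], continuous (fun d : R => Z (Rs + s * d))} ->
  Z (Rs + s * L) = 0 ->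
  (forall d : R, 0 < d < delta -> `|p2 (Rs + s * d) - p2 Rs| <= Lip * d) ->
  0 < a -> 2 * p2 Rs <= a * (2 * m ^+ 2 / Rs ^+ 3 + p2 Rs) ->
  (exists2 k : R, 0 < k & forall d : R, 0 < d < L -> k * (L - d) ^+ 2 <= Z (Rs + s * d)) /\
  (exists C : R, forall d : R, 0 < d < L -> d `^ a * Z (Rs + s * d) <= C).
Proof.
move=> s2 /andP[de0 deL] b0 al0 m0 Lip0 rhob dS dS1 p20 S1Rs SL dZ Z0 cZ ZL p2Lip a0 aE.
have L0 : 0 < L by rewrite (lt_trans de0).
have m20 : 0 < m ^+ 2 by rewrite exprn_even_gt0.
pose rho (d : R) := Rs + s * d.
have rho0 (d : R) : 0 <= d <= L -> 0 < rho d.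
  by move=> /rhob/andP[bd _]; exact: lt_le_trans bd.
have drho (d : R) : is_derive d 1 rho s.
  apply: (is_derive_eq (is_deriveD (is_derive_cst Rs d 1) (is_deriveZ s (is_derive_id d 1)))).
  by rewrite /GRing.scale/= add0r mulr1.
(* With this sign, [T] vanishes at [0] and has derivative [N > 0] on either side, since [s ^ 2 = 1].
   Thus [T] is [|S'|] as a function of the distance, and the stress [sg] has derivative [- T]. *)
pose T d := - s * S1 (rho d).
pose N d := 2 * m ^+ 2 / rho d ^+ 3 + p2 (rho d).
pose sg d := S (rho d).
have B0 : 0 < B.
  have /andP[bB] : b <= Rs + s * L <= B by apply: rhob; rewrite (ltW L0) lexx.
  exact: lt_le_trans (lt_le_trans b0 bB).
pose ka := 2 * m ^+ 2 / B ^+ 3.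
have ka0 : 0 < ka by rewrite /ka divr_gt0 ?exprn_gt0// mulr_gt0.
have dT (d : R) : 0 <= d <= L -> is_derive d 1 T (N d).
  move=> dL; have dc := is_deriveZ (- s) (is_derive1_comp (dS1 _ (rho0 d dL)) (drho d)).
  apply: (is_derive_eq dc); rewrite /GRing.scale/= -/(N d).
  by rewrite -[RHS]mul1r -s2; ring.
have dsg (d : R) : 0 <= d <= L -> is_derive d 1 sg (- T d).
  move=> dL; apply: (is_derive_eq (is_derive1_comp (dS _ (rho0 d dL)) (drho d))).
  by rewrite /T; ring.
have Nka (d : R) : 0 <= d <= L -> ka <= N d.
  move=> dL; have /andP[bd dB] := rhob d dL; have r0 := rho0 d dL.
  rewrite /N /ka -[leLHS]addr0 lerD ?p20//.
  apply: ler_wpM2l; first by rewrite mulr_ge0// ltW.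
  by rewrite lef_pV2 ?posrE ?exprn_gt0// lerXn2r ?nnegrE ?(ltW r0) ?(ltW B0).
have T0 : T 0 = 0 by rewrite /T /rho mulr0 addr0 S1Rs mulr0.
have wL (x d : R) : 0 <= x <= d -> d <= L -> 0 <= x <= L.
  by move=> /andP[-> xd] dL; rewrite (le_trans xd).
have Tka (d : R) : 0 < d < L -> ka * d <= T d.
  move=> /andP[d0 dL]; rewrite -subr_ge0.
  rewrite [leLHS](_ : 0 = T 0 - ka * 0); last by rewrite T0 mulr0 subrr.
  apply: (@is_derive_ge0_le_cc R (fun x => T x - ka * x) (fun x => N x - ka) 0 d (ltW d0)) => x xd.
    apply: (is_derive_eq (is_deriveB (dT x (wL x d xd (ltW dL))) (is_deriveZ ka (is_derive_id x 1)))).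
    by rewrite /GRing.scale/= mulr1.
  have /andP[x0 xd'] := xd.
  by rewrite subr_ge0 Nka// (ltW x0) (le_trans (ltW xd'))// ltW.
have Tgt0 (d : R) : 0 < d < L -> 0 < T d.
  by move=> dL; apply: lt_le_trans (Tka d dL); rewrite mulr_gt0//; case/andP: dL.
(* [sg] vanishes at [L], has derivative [- T], and [T] is nondecreasing. The factor [T d] then
   cancels the denominator of [f], which leaves a multiple of the distance [L - d] to the end
   state. *)
have sg_ge (d : R) : 0 < d < L -> T d * (L - d) <= sg d.
  move=> /andP[d0 dL]; rewrite -subr_ge0.
  rewrite [leLHS](_ : 0 = sg L - T d * (L - L)); last by rewrite /sg /rho SL subrr mulr0 subrr.
  apply: (@is_derive_le0_ge_cc R (fun x => sg x - T d * (L - x)) (fun x => - T x + T d) d L (ltW dL)) => x /andP[dx xL].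
    have x0L : 0 <= x <= L by rewrite xL (le_trans (ltW d0)).
    apply: (is_derive_eq (is_deriveB (dsg x x0L) (is_deriveZ (T d) (is_derive_subl L x)))).
    by rewrite /GRing.scale/=; ring.
  rewrite addrC subr_le0.
  apply: (@is_derive_ge0_le_cc R T N d x (ltW dx)) => z /andP[dz zx].
    by apply: dT; rewrite (ltW (lt_le_trans d0 dz)) (ltW (le_lt_trans zx xL)).
  apply: le_trans (Nka z _); first exact: ltW.
  by rewrite (ltW (lt_trans d0 dz)) (ltW (lt_trans zx xL)).
have sg_le (d : R) : 0 < d < L -> sg d <= S Rs.
  move=> /andP[d0 dL]; rewrite [leRHS](_ : _ = sg 0); last by rewrite /sg /rho mulr0 addr0.
  apply: (@is_derive_le0_ge_cc R sg (fun x => - T x) 0 d (ltW d0)) => x xd.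
    by apply: dsg; exact: wL xd (ltW dL).
  by have /andP[x0 xd'] := xd; rewrite oppr_le0 ltW// Tgt0// x0 (lt_trans xd' dL).
have sg_ge0 (d : R) : 0 < d < L -> 0 <= sg d.
  move=> dL; apply: le_trans (sg_ge d dL); rewrite mulr_ge0 ?(ltW (Tgt0 d dL))//.
  by rewrite subr_ge0; case/andP: dL => _ /ltW.
pose y d := Z (rho d) / rho d ^+ 2.
pose h d := 2 * p2 (rho d) / T d.
pose f d := 2 / al * (sg d / (T d * rho d ^+ 2)).
have lew (d : R) : 0 < d < L -> 0 <= d <= L by move=> /andP[/ltW -> /ltW ->].
have dy (d : R) : 0 < d < L -> is_derive d 1 y (- (h d * y d) - f d).
  move=> dL; have r0 := rho0 d (lew d dL); have rn0 : rho d != 0 by rewrite gt_eqF.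
  have t0 : T d != 0 by rewrite gt_eqF ?Tgt0.
  have S10 : S1 (rho d) = - s * T d.
    by rewrite /T mulrA mulrNN -expr2 s2 mul1r.
  have dZr := @is_derive1_comp R Z rho d _ _ (dZ d dL) (drho d).
  have rr0 : rho d * rho d != 0 by rewrite mulf_neq0.
  have dr2 := is_deriveV (f := fun x => rho x * rho x) rr0 (is_deriveM (drho d) (drho d)).
  apply: (is_derive_eq (is_deriveM dZr dr2)).
  rewrite /GRing.scale !fctE/= -/(rho d) S10 /y /h /f /sg.
  have sn0 : s != 0 by apply/eqP => s0; move: s2; rewrite s0 expr0n/= => /esym/eqP; rewrite oner_eq0.
  have sV : (- s * T d)^-1 = - (s / T d).
    by rewrite mulNr invrN invfM; congr (- (_ * _)); apply: (mulfI sn0); rewrite divff// -expr2.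
  rewrite sV.
  (* [s] enters once through [rho' = s] and once through [(S1)^-1]; writing the target with the
     factor [s ^ 2 = 1] makes it an identity in which [s] is arbitrary. *)
  transitivity (s ^+ 2 * (- (2 * p2 (rho d) / T d * (Z (rho d) / rho d ^+ 2)) -
     2 / al * (S (rho d) / (T d * rho d ^+ 2)))); last by rewrite s2 mul1r.
  by field; rewrite rn0 t0 gt_eqF.
have Tge0 (d : R) : 0 < d < L -> 0 <= T d by move=> dL; exact/ltW/Tgt0.
have h0 (d : R) : 0 < d < L -> 0 <= h d.
  move=> dL; apply: divr_ge0; last exact: Tge0.
  by rewrite mulr_ge0// p20// rho0// lew.
have y0 (d : R) : 0 < d < L -> 0 <= y d.
  by move=> dL; apply: divr_ge0; [exact: Z0|exact/exprn_ge0/ltW/rho0/lew].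
have f0 (d : R) : 0 < d < L -> 0 <= f d.
  move=> dL; apply: mulr_ge0; first by rewrite divr_ge0// ltW.
  apply: divr_ge0; first exact: sg_ge0.
  by apply: mulr_ge0; [exact: Tge0|exact/exprn_ge0/ltW/rho0/lew].
split.
  (* [ode_lower] is used with [c = 2 / (al * B ^ 2)]; the factor [b ^ 2] comes from
     [Z = y * rho ^ 2]. *)
  exists (b ^+ 2 / (al * B ^+ 2)).
    by rewrite divr_gt0 ?mulr_gt0 ?exprn_gt0.
  move=> d dL; have /andP[bd dB] := rhob d (lew d dL); have r0 := rho0 d (lew d dL).
  have cy : {within `]0, L], continuous y}.
    move=> x; apply: cvgM; first exact: cZ.
    apply: (@continuous_in_subspaceT _ _ `]0, L] (fun x => (rho x ^+ 2)^-1)) => t /set_mem/=.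
    rewrite in_itv/= => /andP[t0 tL].
    have rt0 : rho t * rho t != 0 by rewrite mulf_neq0// gt_eqF// rho0// (ltW t0).
    exact: is_derive1_continuous (is_deriveV (f := fun x => rho x * rho x) rt0 (is_deriveM (drho t) (drho t))).
  have hyf x : 0 < x < L -> [/\ 0 <= h x, 0 <= y x & 2 / (al * B ^+ 2) * (L - x) <= f x].
    move=> xL; have rx0 := rho0 x (lew x xL); have /andP[_ xB] := rhob x (lew x xL).
    have tx := Tgt0 x xL; split; [exact: h0|exact: y0|].
    rewrite (_ : 2 / (al * B ^+ 2) * (L - x) = 2 / al * ((L - x) / B ^+ 2)); last first.
      by field; rewrite !gt_eqF.
    apply: ler_wpM2l; first by rewrite divr_ge0 ?(ltW al0).
    have Lx : 0 <= L - x by rewrite subr_ge0; case/andP: xL => _ /ltW.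
    apply: (@le_trans _ _ ((L - x) / rho x ^+ 2)).
      apply: ler_wpM2l => //.
      by rewrite lef_pV2 ?posrE ?exprn_gt0// lerXn2r ?nnegrE ?(ltW rx0) ?(ltW B0).
    rewrite (_ : (L - x) / rho x ^+ 2 = T x * (L - x) / (T x * rho x ^+ 2)); last first.
      by field; rewrite !gt_eqF.
    by apply: ler_wpM2r; [rewrite invr_ge0 mulr_ge0 ?exprn_ge0 ?ltW|exact: sg_ge].
  have yL : y L = 0 by rewrite /y /rho ZL mul0r.
  have yd := ode_lower cy yL dy hyf dL.
  have -> : Z (Rs + s * d) = y d * rho d ^+ 2 by rewrite /y mulfVK// gt_eqF// exprn_gt0.
  rewrite (_ : _ * _ = 2 / (al * B ^+ 2) / 2 * (L - d) ^+ 2 * b ^+ 2); last first.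
    by field; rewrite !gt_eqF.
  apply: ler_pM => //.
  - by rewrite !mulr_ge0 ?invr_ge0 ?mulr_ge0 ?exprn_ge0 ?(ltW al0) ?(ltW B0)// subr_ge0; case/andP: dL => _ /ltW.
  - by rewrite exprn_ge0// ltW.
  - by rewrite lerXn2r ?nnegrE ?(ltW b0) ?(ltW r0).
have Rs_b : b <= Rs <= B by have := rhob 0; rewrite mulr0 addr0 lexx (ltW L0); exact.
have Rs0 : 0 < Rs by case/andP: Rs_b => + _; exact: lt_le_trans.
have SRs0 : 0 <= S Rs.
  have deL' : 0 < delta < L by rewrite de0.
  exact: le_trans (sg_ge0 _ deL') (sg_le _ deL').
(* One-sided Lipschitz constant at [Rs] of [N = - S'']: [Lip] for [p2], the rest for the term in
   [1 / r ^ 3]. *)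
pose L' := Lip + 2 * m ^+ 2 * (3 * B ^+ 2 / b ^+ 6).
have L'0 : 0 <= L'.
  apply: addr_ge0 => //; apply: mulr_ge0; first by rewrite mulr_ge0// ltW.
  by rewrite divr_ge0 ?mulr_ge0 ?exprn_ge0 ?ltW.
have NL (z : R) : 0 < z < delta -> 2 * m ^+ 2 / Rs ^+ 3 + p2 Rs - L' * z <= N z.
  move=> zde; have zL : 0 <= z <= L by case/andP: zde => z0 zd; rewrite (ltW z0) ltW// (lt_trans zd).
  have /andP[bz zB] := rhob z zL; have rz0 := rho0 z zL; have /andP[bR RB] := Rs_b.
  have p2z : p2 Rs - p2 (rho z) <= Lip * z.
    by rewrite (le_trans _ (p2Lip z zde))// distrC ler_norm.
  have z0 : 0 <= z by case/andP: zde => /ltW.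
  have sz : rho z - Rs <= z.
    by rewrite /rho; move/eqP: s2; rewrite sqrf_eq1 => /orP[] /eqP ->; lra.
  have := inv_cube_sub_le b0 bR RB bz zB z0 sz.
  move=> /(ler_wpM2l (_ : 0 <= 2 * m ^+ 2)); rewrite mulr_ge0 ?(ltW m20)// => /(_ isT).
  rewrite -/(rho z) mulrBr mulrA.
  rewrite /N /L'; lra.
(* The claim [h <= a / d + K] reads [2 p2 <= (a / d + K) T]. With [T d = N z * d], replacing [N z]
   and [p2 (rho d)] by their values at [Rs] costs at most [(a * L' + 2 * Lip) * d], and [K * T d]
   pays for this because [T d >= ka * d]. The constant [M] follows from [sg <= S Rs],
   [T d >= ka * d] and [rho >= b]. *)
pose K := (a * L' + 2 * Lip) / ka.
pose M := 2 / al * (S Rs / (ka * b ^+ 2)).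
have K0 : 0 <= K.
  by apply: divr_ge0; [rewrite addr_ge0 ?mulr_ge0// ltW|exact: ltW].
have M0 : 0 <= M.
  apply: mulr_ge0; first by rewrite divr_ge0// ltW.
  by apply: divr_ge0 => //; apply: mulr_ge0; [exact: ltW|exact/exprn_ge0/ltW].
have [|||||C Cy] := @ode_upper R L delta a K M y h f _ a0 _ _ dy.
- by rewrite de0.
- exact: K0.
- exact: M0.
- by move=> x xL; split; [exact: h0|exact: y0|exact: f0].
- move=> d dde; have /andP[d0 dd] := dde; have dL : 0 < d < L by rewrite d0 (lt_trans dd).
  have td := Tgt0 d dL; have tka := Tka d dL; have /andP[bd dB] := rhob d (lew d dL).
  have r0 := rho0 d (lew d dL); split.
    have dT' (z : R) : z \in `]0, d[%R -> is_derive z 1 T (N z).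
      by rewrite in_itv/= => /andP[z0 zd]; apply: dT; apply: lew; rewrite z0 (lt_trans zd)//; case/andP: dL.
    have [|z zd] := MVT d0 dT'.
      apply: (@is_derive_within_continuous _ _ N) => x xd; apply: dT; apply: wL xd _.
      by case/andP: dL => _ /ltW.
    rewrite T0 !subr0 => TE; have /andP[z0 zd'] : 0 < z < d by rewrite in_itv in zd.
    have Nz := NL z (introT andP (conj z0 (lt_trans zd' dd))).
    have p2d : 2 * p2 (rho d) <= 2 * p2 Rs + 2 * (Lip * d).
      rewrite -mulrDr ler_pM2l// -lerBlDl (le_trans (ler_norm _))//; exact: p2Lip.
    rewrite /h ler_pdivrMr// (le_trans p2d)//.
    rewrite (_ : (a / d + K) * T d = a * N z + K * (N z * d)); last by rewrite TE; field; rewrite gt_eqF.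
    have KN : (a * L' + 2 * Lip) * d <= K * (N z * d).
      rewrite (_ : (a * L' + 2 * Lip) * d = K * (ka * d)); last by rewrite /K; field; rewrite gt_eqF.
      by rewrite -TE ler_wpM2l.
    have : a * (2 * m ^+ 2 / Rs ^+ 3 + p2 Rs) <= a * (N z + L' * d).
      rewrite ler_pM2l//; have : L' * z <= L' * d by rewrite ler_wpM2l// ltW.
      lra.
    lra.
  rewrite (_ : M / d = 2 / al * (S Rs / (ka * d * b ^+ 2))); last first.
    by rewrite /M; field; rewrite !gt_eqF.
  have kd0 : 0 < ka * d * b ^+ 2 by apply: mulr_gt0; [exact: mulr_gt0|exact: exprn_gt0].
  have Tr0 : 0 < T d * rho d ^+ 2 by apply: mulr_gt0 => //; exact: exprn_gt0.
  apply: ler_wpM2l; first by rewrite divr_ge0// ltW.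
  apply: ler_pM; [exact: sg_ge0|by rewrite invr_ge0 ltW|exact: sg_le|].
  rewrite lef_pV2 ?posrE//; apply: ler_pM => //; [by apply: mulr_ge0; exact: ltW|exact/exprn_ge0/ltW|].
  by rewrite lerXn2r ?nnegrE ?(ltW r0) ?(ltW b0).
exists (C * B ^+ 2) => d dL; have /andP[bd dB] := rhob d (lew d dL); have r0 := rho0 d (lew d dL).
have -> : Z (Rs + s * d) = y d * rho d ^+ 2 by rewrite /y mulfVK// gt_eqF// exprn_gt0.
rewrite mulrA; apply: ler_pM; [|exact/exprn_ge0/ltW|exact: Cy|].
  by apply: mulr_ge0; [exact: powR_ge0|exact: y0].
by rewrite lerXn2r ?nnegrE ?(ltW r0) ?(ltW B0).
Qed.

(** * Consequences of a weighted bound on the derivative *)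

(** Being odd, this power is increasing through [0] and has the same derivative formula on both
    sides, so that one function of [u - us] handles the subsonic and the supersonic parts
    together. *)
Definition spow (R : realType) (th t : R) : R := Num.sg t * `|t| `^ th.

Lemma is_derive_spow (R : realType) (th t : R) : t != 0 ->
  is_derive t 1 (spow th) (th * `|t| `^ (th - 1)).
Proof.
move=> t0; have [t_lt0|t_gt0|t_eq0] := ltgtP t 0; last by rewrite t_eq0 eqxx in t0.
- have dl : is_derive t 1 (fun u : R => - u) (- 1) by exact: is_deriveN.
  have Nt0 : 0 < - t by rewrite oppr_gt0.
  have dp := is_deriveN (@is_derive1_comp R (fun y => y `^ th) (fun u => - u) t _ _ (is_derive_powR th Nt0) dl).
  apply: (near_eq_is_derive _ (is_derive_eq dp _)); last first.
    by rewrite ltr0_norm// mulrN1 opprK.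
  near=> u; rewrite /spow/= !fctE/=.
  have u0 : u < 0 by near: u; exact: lt_nbhsl.
  by rewrite ltr0_sg// ltr0_norm// mulN1r.
- apply: (near_eq_is_derive _ (is_derive_eq (is_derive_powR th t_gt0) _)); last by rewrite gtr0_norm.
  near=> u; rewrite /spow/=.
  have u0 : 0 < u by near: u; exact: lt_nbhsr.
  by rewrite gtr0_sg// gtr0_norm// mul1r.
Unshelve. all: by end_near. Qed.

Lemma spow_norm (R : realType) (th t : R) : 0 < th -> `|spow th t| = `|t| `^ th.
Proof.
move=> th0; rewrite /spow normrM normr_sg; have [->|t0] := eqVneq t 0.
  by rewrite normr0 mul0r powR0// gt_eqF.
by rewrite mul1r ger0_norm// powR_ge0.
Qed.

Lemma spow_continuous (R : realType) (th : R) : 0 < th -> continuous (spow th).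
Proof.
move=> th0 t; have [->|t0] := eqVneq t 0; last first.
  exact: is_derive1_continuous (is_derive_spow th t0).
rewrite /continuous_at (_ : spow th 0 = 0); last by rewrite /spow sgr0 mul0r.
apply/cvgrPdist_lt => e e0; near=> x; rewrite sub0r normrN spow_norm//.
have ee : e = (e `^ th^-1) `^ th by rewrite -powRrM mulVf ?gt_eqF// powRr1// ltW.
rewrite [ltRHS]ee gt0_ltr_powR ?nnegrE ?powR_ge0//.
near: x; exists (e `^ th^-1) => /=; first exact: powR_gt0.
by move=> z /=; rewrite sub0r normrN.
Unshelve. all: by end_near. Qed.

(** Write each power as [t * t ^ (th - 1)] and bound both [(u - v) ^ (th - 1)] and [v ^ (th - 1)] by
    [u ^ (th - 1)]. *)
Lemma powR_superadd (R : realType) (th u v : R) : 1 <= th -> 0 <= v -> v <= u ->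
  (u - v) `^ th <= u `^ th - v `^ th.
Proof.
move=> th1 v0 vu; have u0 : 0 <= u by exact: le_trans vu.
have th0 : 0 < th by exact: lt_le_trans th1.
have uv0 : 0 <= u - v by rewrite subr_ge0.
have th10 : 0 <= th - 1 by rewrite subr_ge0.
rewrite lerBrDr -(mulr_powRB1 uv0 th0) -(mulr_powRB1 v0 th0) -(mulr_powRB1 u0 th0).
apply: (@le_trans _ _ ((u - v) * u `^ (th - 1) + v * u `^ (th - 1))); last by rewrite -mulrDl subrK.
by rewrite lerD// ler_wpM2l// ge0_ler_powR ?nnegrE// gerBl.
Qed.

(** This says that the inverse of [spow th] is Hoelder continuous with exponent [1 / th]. For equal
    signs it is superadditivity of the power; for opposite signs [|u - v|] is at most twice the
    larger modulus, whence the constant [2 ^ th]. *)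
Lemma powR_dist_le_spow (R : realType) (th u v : R) : 1 <= th ->
  `|u - v| `^ th <= 2 `^ th * `|spow th u - spow th v|.
Proof.
move=> th1; have th0 : 0 < th by exact: lt_le_trans th1.
have two1 : 1 <= 2 `^ th :> R by have := ler_powR (ler1n R 2) (ltW th0); rewrite powRr0.
have main (x y : R) : y <= x -> 0 <= x -> (x - y) `^ th <= 2 `^ th * (spow th x - spow th y).
  move=> yx x0; have spx : spow th x = x `^ th.
    rewrite /spow ger0_norm//; have [->|xn0] := eqVneq x 0.
      by rewrite powR0 ?mulr0// gt_eqF.
    by rewrite gtr0_sg ?mul1r// lt_neqAle eq_sym xn0.
  rewrite spx; have [y0|y0] := leP 0 y.
    have spy : spow th y = y `^ th.
      rewrite /spow ger0_norm//; have [->|yn0] := eqVneq y 0.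
        by rewrite powR0 ?mulr0// gt_eqF.
      by rewrite gtr0_sg ?mul1r// lt_neqAle eq_sym yn0.
    rewrite spy; apply: le_trans (powR_superadd th1 y0 yx) _.
    by rewrite ler_peMl// subr_ge0 ge0_ler_powR ?nnegrE ?(ltW th0).
  have Ny0 : 0 <= - y by rewrite oppr_ge0 ltW.
  rewrite /spow ltr0_sg// ltr0_norm// mulN1r opprK.
  apply: (@le_trans _ _ ((2 * Num.max x (- y)) `^ th)).
    rewrite ge0_ler_powR ?nnegrE ?(ltW th0)//; first by rewrite addr_ge0.
      by rewrite mulr_ge0// le_max x0.
    by rewrite mulr2n mulrDl mul1r lerD// le_max lexx ?orbT.
  rewrite powRM// ?le_max ?x0//; apply: ler_wpM2l; first exact: powR_ge0.
  by rewrite /Num.max; case: ifP => _; rewrite ?lerDl ?lerDr powR_ge0.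
have mainN (x y : R) : y <= x -> (x - y) `^ th <= 2 `^ th * (spow th x - spow th y).
  move=> yx; have [x0|x0] := leP 0 x; first exact: main.
  have spN (z : R) : spow th (- z) = - spow th z by rewrite /spow sgrN normrN mulNr.
  have := main (- y) (- x); rewrite !spN !opprK lerN2 oppr_ge0 [- y + x]addrC.
  by rewrite [- spow th y + _]addrC; apply => //; rewrite (le_trans yx)// ltW.
wlog vu : u v / v <= u.
  move=> H; have [vu|/ltW uv] := leP v u; first exact: H.
  by rewrite distrC [`|spow th u - _|]distrC; exact: H.
rewrite ger0_norm ?subr_ge0//; apply: le_trans (mainN _ _ vu) _.
by apply: ler_wpM2l; [exact: powR_ge0|exact: ler_norm].
Qed.

(** Openness makes [derive1 f] agree with [f1] near each point of [A], so that continuity passes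
    from [f1] to [derive1 f]. *)
Lemma C1_on_intro (R : realType) (A : set R) (f f1 : R -> R) : open A ->
  (forall x, A x -> is_derive x 1 f (f1 x)) ->
  (forall x, A x -> {for x, continuous f1}) -> C1_on A f.
Proof.
move=> oA df cf1 x Ax; split; first by case: (df x Ax).
have near_f1 : \forall y \near x, f1 y = derive1 f y.
  by apply: filterS (oA x Ax) => y /df/is_derive1_eq.
rewrite /prop_for /continuous_at (is_derive1_eq (df x Ax)).
by apply: cvg_trans (cf1 x Ax); apply: near_eq_cvg.
Qed.

Lemma C2_on_intro (R : realType) (A : set R) (f f1 f2 : R -> R) : open A ->
  (forall x, A x -> is_derive x 1 f (f1 x)) ->
  (forall x, A x -> is_derive x 1 f1 (f2 x)) ->
  (forall x, A x -> {for x, continuous f2}) -> C2_on A f.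
Proof.
move=> oA df df1 cf2; split.
  by apply: (C1_on_intro oA df) => x /df1; exact: is_derive1_continuous.
apply: (C1_on_intro oA _ cf2) => x Ax; apply: near_eq_is_derive (df1 x Ax).
by apply: filterS (oA x Ax) => y /df/is_derive1_eq.
Qed.

Lemma is_derive_spow_sub (R : realType) (th us x : R) (u : R -> R) :
  derivable u x 1 -> u x != us ->
  is_derive x 1 (fun y => spow th (u y - us)) (th * `|u x - us| `^ (th - 1) * derive1 u x).
Proof.
move=> du uxs; have uxs0 : u x - us != 0 by rewrite subr_eq0.
have dus : is_derive x 1 (fun y => u y - us) (derive1 u x).
  apply: (is_derive_eq (is_deriveB (is_derive_derive1 du) (is_derive_cst us x 1))).
  by rewrite subr0.
exact: (@is_derive1_comp R (spow th) (fun y => u y - us) x _ _ (is_derive_spow th uxs0) dus).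
Qed.

Lemma powR_norm_continuous (R : realType) (th t : R) : t != 0 ->
  {for t, continuous (fun s : R => `|s| `^ th)}.
Proof.
move=> t0; have nt0 : 0 < `|t| by rewrite normr_gt0.
apply: (@continuous_comp _ _ _ (fun s : R => `|s|) (fun y : R => y `^ th)).
  exact: norm_continuous.
exact: is_derive1_continuous (is_derive_powR th nt0).
Qed.

Lemma C1_on_spow_sub (R : realType) (th us x0 : R) (u : R -> R) :
  C1_on [set~ x0] u -> (forall x, x != x0 -> u x != us) ->
  C1_on [set~ x0] (fun y => spow th (u y - us)).
Proof.
move=> C1u uus; 
apply: (@C1_on_intro R [set~ x0] _ (fun x => th * `|u x - us| `^ (th - 1) * derive1 u x)).
- exact: open_setC1.
- move=> x xx0; apply: is_derive_spow_sub (C1u x xx0).1 _; exact/uus/eqP.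
move=> x xx0.
apply: continuousM; last exact: (C1u x xx0).2.
apply: continuousM; first exact: cst_continuous.
apply: (@continuous_comp _ _ _ (fun y => u y - us) (fun s : R => `|s| `^ (th - 1))).
  by apply: continuousB; [exact: derivable1_continuous (C1u x xx0).1|exact: cst_continuous].
by apply: powR_norm_continuous; rewrite subr_eq0; exact/uus/eqP.
Qed.

(* [derive1 u `^ r] is bounded by a multiple of the derivative of the bounded
   increasing function [spow th (u - us)], [th = 1 - a / 2 * (r - 1)]. *)
Lemma integrable_derive1_powR (R : realType) (us x0 a r B K : R) (u : R -> R) :
  continuous u -> C1_on [set~ x0] u -> (forall x, x != x0 -> u x != us) ->
  (forall x, x != x0 -> 0 <= derive1 u x) -> (forall x, `|u x - us| <= B) ->
  (forall x, x != x0 -> `|u x - us| `^ (a / 2) * derive1 u x <= K) ->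
  1 <= r -> a / 2 * (r - 1) < 1 ->
  (@lebesgue_measure R).-integrable setT (fun x => (`|derive1 u x| `^ r)%:E).
Proof.
move=> cu C1u uus u'0 uB uK r1 ar; have r0 : 0 < r by exact: lt_le_trans r1.
have r10 : 0 <= r - 1 by rewrite subr_ge0.
pose th := 1 - a / 2 * (r - 1); have th0 : 0 < th by rewrite subr_gt0.
pose G x := spow th (u x - us).
have C1G : C1_on [set~ x0] G by exact: C1_on_spow_sub.
have G'E x : x != x0 -> derive1 G x = th * `|u x - us| `^ (th - 1) * derive1 u x.
  move=> xx0; apply: is_derive1_eq; apply: is_derive_spow_sub (uus _ xx0).
  by have /eqP/C1u[] := xx0.
have cG : continuous G.
  move=> x; apply: (@continuous_comp _ _ _ (fun y => u y - us) (spow th)).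
    by apply: continuousB; [exact: cu|exact: cst_continuous].
  exact: spow_continuous.
have intG : (@lebesgue_measure R).-integrable setT (EFin \o derive1 G).
  apply: (integrable_monotone_derivative (B := B `^ th) cG C1G).
    by move=> x xx0; rewrite G'E// mulr_ge0 ?u'0// mulr_ge0 ?powR_ge0// ltW.
  move=> x; rewrite /G spow_norm// ge0_ler_powR ?nnegrE ?(ltW th0) ?uB//.
  exact: le_trans (uB x).
have mu' : measurable_fun setT (derive1 u).
  by apply: (@measurable_off_point _ x0) => x /eqP/C1u[].
have K0 : 0 <= K.
  have x1 : x0 + 1 != x0 by rewrite -subr_eq0 addrAC subrr add0r oner_eq0.
  by apply: le_trans (uK _ x1); rewrite mulr_ge0 ?powR_ge0 ?u'0.
have intKG := integrableZl measurableT (K `^ (r - 1) / th) intG.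
apply: (le_integrable_off_point (x0 := x0)
  (g := fun x => K `^ (r - 1) / th * derive1 G x)) => //.
  exact: measurable_normr_powR.
move=> x xx0; have u'x := u'0 x xx0.
have D0 : 0 < `|u x - us| by rewrite normr_gt0 subr_eq0 uus.
rewrite ger0_norm ?powR_ge0// ger0_norm// G'E//.
rewrite (_ : _ * (_ * _ * _) = derive1 u x * (K `^ (r - 1) * `|u x - us| `^ (th - 1))); last first.
  by field; rewrite gt_eqF.
(* One factor of [u' ^ r = u' * u' ^ (r - 1)] is kept. The other is bounded through
   [u' <= K * |u - us| ^ (- a / 2)], whose power [r - 1] has exponent [th - 1]. *)
rewrite -mulr_powRB1//; apply: ler_wpM2l => //.
rewrite (_ : th - 1 = - (a / 2) * (r - 1)); last by rewrite /th; ring.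
rewrite powRrM -powRM ?powR_ge0//.
rewrite ge0_ler_powR ?nnegrE ?mulr_ge0 ?powR_ge0//.
by rewrite powRN ler_pdivlMr ?powR_gt0// mulrC uK.
Qed.

Lemma holder_of_weighted_derivative (R : realType) (us x0 a K : R) (u : R -> R) :
  continuous u -> C1_on [set~ x0] u -> (forall x, x != x0 -> u x != us) ->
  (forall x, x != x0 -> 0 <= derive1 u x) -> 0 < a ->
  (forall x, x != x0 -> `|u x - us| `^ (a / 2) * derive1 u x <= K) ->
  exists C, forall x y, `|u x - u y| <= C * `|x - y| `^ (1 + a / 2)^-1.
Proof.
move=> cu C1u uus u'0 a0 uK; pose th := 1 + a / 2.
have th1 : 1 <= th by rewrite lerDl divr_ge0// ltW.
have th0 : 0 < th by exact: lt_le_trans th1.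
pose G x := spow th (u x - us).
have cG : continuous G.
  move=> x; apply: (@continuous_comp _ _ _ (fun y => u y - us) (spow th)).
    by apply: continuousB; [exact: cu|exact: cst_continuous].
  exact: spow_continuous.
have K0 : 0 <= K.
  have x1 : x0 + 1 != x0 by rewrite -subr_eq0 addrAC subrr add0r oner_eq0.
  by apply: le_trans (uK _ x1); rewrite mulr_ge0 ?powR_ge0 ?u'0.
have Glip x y : x <= y -> `|G y - G x| <= th * K * `|y - x|.
  move=> xy; rewrite (ger0_norm (_ : 0 <= y - x)) ?subr_ge0//.
  apply: (@MVT_off_point R x0 _ x y G
    (fun x => th * `|u x - us| `^ (th - 1) * derive1 u x) xy).
  - exact: continuous_subspaceT.
  - move=> z _ zx0; apply: is_derive_spow_sub (uus _ zx0).
    by have /eqP/C1u[] := zx0.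
  - move=> z _ zx0; rewrite ger0_norm; last first.
      by rewrite mulr_ge0 ?u'0// mulr_ge0 ?powR_ge0// ltW.
    rewrite -mulrA ler_pM2l// (_ : th - 1 = a / 2) ?uK//.
    by rewrite /th addrAC subrr add0r.
have Glip' x y : `|G x - G y| <= th * K * `|x - y|.
  have [xy|/ltW yx] := leP x y; last exact: Glip.
  by rewrite distrC (distrC x); exact: Glip.
(* [th * K] is the Lipschitz constant of [G], and [2 ^ th] is the cost of inverting [spow th]. *)
exists ((2 `^ th * (th * K)) `^ th^-1) => x y.
have C0 : 0 <= 2 `^ th * (th * K) by rewrite mulr_ge0 ?powR_ge0// mulr_ge0// ltW.
have -> : `|u x - u y| = (`|u x - u y| `^ th) `^ th^-1.
  by rewrite -powRrM mulfV ?gt_eqF// powRr1.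
rewrite -powRM//; apply: ge0_ler_powR; rewrite ?nnegrE ?invr_ge0 ?(ltW th0) ?powR_ge0//.
  by apply: mulr_ge0.
rewrite (_ : u x - u y = (u x - us) - (u y - us)); last by ring.
apply: le_trans (powR_dist_le_spow _ _ th1) _.
by rewrite -mulrA ler_wpM2l ?powR_ge0// Glip'.
Qed.

(** * Nonlinear functions of the profile *)

Lemma C2_on_cst (R : realType) (A : set R) (k : R) : open A -> C2_on A (fun=> k).
Proof.
move=> oA; apply: (@C2_on_intro R A _ (fun=> 0) (fun=> 0)) => // x _.
exact: cst_continuous.
Qed.

Lemma C2_on_id (R : realType) (A : set R) : open A -> C2_on A (fun x => x).
Proof.
move=> oA; apply: (@C2_on_intro R A _ (fun=> 1) (fun=> 0)) => // x _.
exact: cst_continuous.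
Qed.

Lemma C2_onP (R : realType) (A : set R) (f : R -> R) : open A ->
  C2_on A f <-> exists f1 f2, forall x, A x -> [/\ is_derive x 1 f (f1 x),
    is_derive x 1 f1 (f2 x) & {for x, continuous f2}].
Proof.
move=> oA; split=> [[C1f C1f']|[f1 [f2 fA]]].
  exists (derive1 f), (derive1 (derive1 f)) => x Ax.
  split; [exact: is_derive_derive1 (C1f x Ax).1|exact: is_derive_derive1 (C1f' x Ax).1|].
  exact: (C1f' x Ax).2.
by apply: (C2_on_intro oA (f1 := f1) (f2 := f2)) => x /fA[].
Qed.

Lemma C2_onD (R : realType) (A : set R) (f g : R -> R) : open A ->
  C2_on A f -> C2_on A g -> C2_on A (fun x => f x + g x).
Proof.
move=> oA /(C2_onP _ oA)[f1 [f2 fA]] /(C2_onP _ oA)[g1 [g2 gA]].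
apply/(C2_onP _ oA); exists (fun x => f1 x + g1 x), (fun x => f2 x + g2 x) => x Ax.
have [df df1 cf2] := fA x Ax; have [dg dg1 cg2] := gA x Ax.
split; [exact: is_deriveD df dg|exact: is_deriveD df1 dg1|exact: continuousD cf2 cg2].
Qed.

Lemma C2_onM (R : realType) (A : set R) (f g : R -> R) : open A ->
  C2_on A f -> C2_on A g -> C2_on A (fun x => f x * g x).
Proof.
move=> oA /(C2_onP _ oA)[f1 [f2 fA]] /(C2_onP _ oA)[g1 [g2 gA]].
apply/(C2_onP _ oA); exists (fun x => f x * g1 x + g x * f1 x),
  (fun x => f x * g2 x + g1 x * f1 x + (g x * f2 x + f1 x * g1 x)) => x Ax.
have [df df1 cf2] := fA x Ax; have [dg dg1 cg2] := gA x Ax.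
have cf := is_derive1_continuous df; have cf1 := is_derive1_continuous df1.
have cg := is_derive1_continuous dg; have cg1 := is_derive1_continuous dg1.
split.
- exact: is_deriveM df dg.
- exact: is_deriveD (is_deriveM df dg1) (is_deriveM dg df1).
- exact: continuousD (continuousD (continuousM cf cg2) (continuousM cg1 cf1))
    (continuousD (continuousM cg cf2) (continuousM cf1 cg1)).
Qed.

Lemma C2_on_comp (R : realType) (A B : set R) (g u : R -> R) : open A -> open B ->
  C2_on B g -> C2_on A u -> (forall x, A x -> B (u x)) -> C2_on A (fun x => g (u x)).
Proof.
move=> oA oB /(C2_onP _ oB)[g1 [g2 gB]] /(C2_onP _ oA)[u1 [u2 uA]] AB.
apply/(C2_onP _ oA); exists (fun x => g1 (u x) * u1 x),
  (fun x => g1 (u x) * u2 x + u1 x * (g2 (u x) * u1 x)) => x Ax.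
have [du du1 cu2] := uA x Ax; have [dg dg1 cg2] := gB (u x) (AB x Ax).
have cu := is_derive1_continuous du; have cu1 := is_derive1_continuous du1.
have cg1 := is_derive1_continuous dg1.
split.
- exact: (@is_derive1_comp R g u x _ _ dg du).
- exact: is_deriveM (@is_derive1_comp R g1 u x _ _ dg1 du) du1.
- have cg1u : {for x, continuous (fun y => g1 (u y))} by exact: continuous_comp cu cg1.
  have cg2u : {for x, continuous (fun y => g2 (u y))} by exact: continuous_comp cu cg2.
  exact: continuousD (continuousM cg1u cu2) (continuousM cu1 (continuousM cg2u cu1)).
Qed.

Lemma C2_on_inv (R : realType) : C2_on (`]0, +oo[ : set R) (fun x => x^-1).
Proof.
apply: (@C2_on_intro R `]0, +oo[ _ (fun x => - (x^-1 * x^-1)) (fun x => 2 * (x^-1 * x^-1 * x^-1))).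
- exact: interval_open.
- move=> x /=; rewrite in_itv/= andbT => x0; have xn0 : x != 0 by rewrite gt_eqF.
  apply: (is_derive_eq (is_deriveV xn0 (is_derive_id x 1))).
  by rewrite /GRing.scale/=; field.
- move=> x /=; rewrite in_itv/= andbT => x0; have xn0 : x != 0 by rewrite gt_eqF.
  have dV := is_deriveV xn0 (is_derive_id x 1).
  apply: (is_derive_eq (is_deriveN (is_deriveM dV dV))).
  by rewrite /GRing.scale/=; field.
- move=> x /=; rewrite in_itv/= andbT => x0; have xn0 : x != 0 by rewrite gt_eqF.
  have cV : {for x, continuous (fun y : R => y^-1)}.
    exact: is_derive1_continuous (is_deriveV xn0 (is_derive_id x 1)).
  apply: continuousM; first exact: cst_continuous.
  by apply: continuousM => //; apply: continuousM.
Qed.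

Lemma segment_bounded (R : realType) (a b : R) (f : R -> R) :
  {within `[a, b], continuous f} -> exists M : R, forall x, a <= x <= b -> `|f x| <= M.
Proof.
move=> cf; have /compact_bounded[N [Nreal NP]] : compact (f @` `[a, b]).
  by apply: continuous_compact => //; exact: segment_compact.
exists (N + 1) => x xab; apply: (NP (N + 1)); first by rewrite ltrDl.
by exists x => //=; rewrite in_itv.
Qed.

Lemma C1_bounded_lipschitz (R : realType) (a b : R) (g g1 : R -> R) :
  (forall x, a <= x <= b -> is_derive x 1 g (g1 x)) ->
  (forall x, a <= x <= b -> {for x, continuous g1}) ->
  exists2 M, 0 <= M & forall x, a <= x <= b ->
    [/\ `|g x| <= M, `|g1 x| <= M &
        forall y, a <= y <= b -> `|g x - g y| <= M * `|x - y|].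
Proof.
move=> dg cg1.
have [M0 gM0] := segment_bounded (is_derive_within_continuous dg).
have [M1 gM1] : exists M : R, forall x, a <= x <= b -> `|g1 x| <= M.
  apply: segment_bounded => x; apply: (@continuous_in_subspaceT _ _ `[a, b]) => t /set_mem/=.
  by rewrite in_itv/= => /cg1.
have lip x y : a <= x -> x <= y -> y <= b -> `|g y - g x| <= M1 * (y - x).
  move=> ax xy yb; have sub z : x <= z <= y -> a <= z <= b.
    by move=> /andP[xz zy]; rewrite (le_trans ax xz) (le_trans zy yb).
  (* There is no exceptional point here: [x - 1] lies outside [[x, y]]. *)
  apply: (@MVT_off_point R (x - 1) M1 x y g g1 xy).
  - by apply: (@is_derive_within_continuous _ _ g1) => z /sub/dg.
  - by move=> t /andP[/ltW xt /ltW ty] _; apply/dg/sub; rewrite xt.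
  - by move=> t /andP[/ltW xt /ltW ty] _; apply/gM1/sub; rewrite xt.
exists (Num.max `|M0| `|M1|); first by rewrite le_max normr_ge0.
move=> x xab; split.
- by rewrite le_max (le_trans (gM0 x xab)) ?ler_norm.
- by apply: (le_trans (gM1 x xab)); rewrite le_max ler_norm orbT.
- move=> y yab; have /andP[ax xb] := xab; have /andP[ay yb] := yab.
  apply: (@le_trans _ _ (M1 * `|x - y|)).
    have [yx|/ltW xy] := leP y x.
      by rewrite (ger0_norm (_ : 0 <= x - y)) ?subr_ge0//; exact: lip.
    by rewrite distrC (distrC x) (ger0_norm (_ : 0 <= y - x)) ?subr_ge0//; exact: lip.
  by rewrite ler_wpM2r// le_max ler_norm orbT.
Qed.

Lemma in_LpB (R : realType) (p : \bar R) (f g : R -> R) : (1 <= p)%E ->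
  in_Lp p f -> in_Lp p g -> in_Lp p (fun x => f x - g x).
Proof.
move=> p1 pf pg.
have pNg := Lfun_oppr_closed pg.
exact: (Lfun_addr_closed (@lebesgue_measure R) p1).2 pf pNg.
Qed.

Lemma integrable_compact_support (R : realType) (a b : R) (k : R -> R) :
  continuous k -> (forall x, ~~ (a <= x <= b) -> k x = 0) ->
  (@lebesgue_measure R).-integrable setT (EFin \o k).
Proof.
move=> ck k0; have -> : EFin \o k = (EFin \o k) \_ `[a, b].
  apply/funext => x; rewrite patchE; case: ifPn => // /negP xab /=.
  by rewrite k0//; apply/negP => axb; apply: xab; apply/mem_set; rewrite /= in_itv.
apply/integrable_restrict => //=; rewrite setTI.
apply: continuous_compact_integrable; first exact: segment_compact.
exact: continuous_subspaceT.
Qed.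

Lemma bounded_compact_support (R : realType) (a b : R) (k : R -> R) :
  continuous k -> (forall x, ~~ (a <= x <= b) -> k x = 0) ->
  exists M : R, forall x, `|k x| <= M.
Proof.
move=> ck k0; have [M kM] := @segment_bounded R a b k (continuous_subspaceT ck).
exists `|M| => x; have [xab|/k0 ->] := boolP (a <= x <= b); last by rewrite normr0.
exact: le_trans (kM x xab) (ler_norm _).
Qed.

Lemma in_Lp_compact_support (R : realType) (a b : R) (k : R -> R) (p : \bar R) :
  continuous k -> (forall x, ~~ (a <= x <= b) -> k x = 0) -> (1 <= p)%E -> in_Lp p k.
Proof.
move=> ck k0; have [M kM] := bounded_compact_support ck k0.
by apply: in_Lp_bounded_integrable kM; exact: integrable_compact_support ck k0.
Qed.

Lemma integrable_powR1 (R : realType) (f : R -> R) :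
  (@lebesgue_measure R).-integrable setT (fun x => (`|f x| `^ 1)%:E) ->
  measurable_fun setT f -> (@lebesgue_measure R).-integrable setT (EFin \o f).
Proof.
move=> intf mf; apply: (le_integrable_off_point (x0 := 0) (g := fun x => `|f x| `^ 1)) => // x _.
by rewrite powRr1.
Qed.

(** The chain rule supplies an explicit [f1], whereas [deriv_in_Lp] is about [derive1 f]; the two
    agree off the null set [[set x0]]. Integrability of [f1] itself makes the weak derivative
    meaningful, and that of the power [r] gives the norm. *)
Lemma deriv_in_Lp_off_point (R : realType) (x0 r : R) (f f1 : R -> R) :
  continuous f -> (forall x, x != x0 -> is_derive x 1 f (f1 x)) ->
  (forall x, x != x0 -> {for x, continuous f1}) ->
  (@lebesgue_measure R).-integrable setT (EFin \o f1) ->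
  (@lebesgue_measure R).-integrable setT (fun x => (`|f1 x| `^ r)%:E) ->
  deriv_in_Lp r%:E f.
Proof.
move=> cf df cf1 int1 intr.
have C1f : C1_on [set~ x0] f.
  apply: (@C1_on_intro R [set~ x0] f f1) => [|x /eqP xx0|x /eqP xx0].
  - exact: open_setC1.
  - exact: df.
  - exact: cf1.
have dE x : x != x0 -> derive1 f x = f1 x by move=> xx0; exact: is_derive1_eq (df x xx0).
have cd x : x != x0 -> {for x, continuous (derive1 f)} by move=> /eqP/C1f[].
have dd x : x != x0 -> is_derive x 1 f (derive1 f x).
  by move=> xx0; rewrite dE//; exact: df.
have md : measurable_fun setT (derive1 f) by exact: measurable_off_point cd.
split.
  apply: (weak_derivative_off_point cf dd cd); apply: open_integrable_locally; first exact: openT.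
  apply: (le_integrable_off_point (x0 := x0) (g := fun x => `|f1 x|)) => //.
    by move=> x xx0; rewrite dE.
  exact: integrable_norm int1.
apply: in_Lp_powR => //.
apply: (le_integrable_off_point (x0 := x0) (g := fun x => `|f1 x| `^ r)) => //.
  exact: measurable_normr_powR.
by move=> x xx0; rewrite dE// ger0_norm// powR_ge0.
Qed.

Lemma integrable_powR_mul (R : realType) (M r : R) (k f : R -> R) : 0 <= r ->
  measurable_fun setT (fun x => k x * f x) -> (forall x, `|k x| <= M) ->
  (@lebesgue_measure R).-integrable setT (fun x => (`|f x| `^ r)%:E) ->
  (@lebesgue_measure R).-integrable setT (fun x => (`|k x * f x| `^ r)%:E).
Proof.
move=> r0 mkf kM intf.
have M0 : 0 <= M by exact: le_trans (kM 0).
apply: (le_integrable_off_point (x0 := 0) (g := fun x => M `^ r * `|f x| `^ r)).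
- exact: measurable_normr_powR.
- move=> x _; rewrite ger0_norm ?powR_ge0// normrM powRM//.
  by rewrite ler_wpM2r ?powR_ge0// ge0_ler_powR ?nnegrE.
- by have := integrableZl measurableT (M `^ r) intf.
Qed.

Lemma continuous_for (R : realType) (f : R -> R) :
  (forall x : R, {for x, continuous f}) -> continuous f.
Proof. by []. Qed.

Lemma continuous_at_comp (R : realType) (f h : R -> R) (x : R) :
  {for x, continuous f} -> {for f x, continuous h} ->
  {for x, continuous (fun y => h (f y))}.
Proof. by move=> cf ch; exact: (@continuous_comp _ _ _ f h). Qed.

Lemma in_W1p_sub (R : realType) (x0 r a b : R) (f f1 k k1 : R -> R) : 1 <= r ->
  continuous f -> (forall x, x != x0 -> is_derive x 1 f (f1 x)) ->
  (forall x, x != x0 -> {for x, continuous f1}) -> measurable_fun setT f1 ->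
  (@lebesgue_measure R).-integrable setT (EFin \o f1) ->
  (@lebesgue_measure R).-integrable setT (fun x => (`|f1 x| `^ r)%:E) ->
  (forall x : R, is_derive x 1 k (k1 x)) -> continuous k1 ->
  (forall x, ~~ (a <= x <= b) -> k1 x = 0) ->
  in_Lp r%:E (fun x => f x - k x) -> in_W1p r%:E (fun x => f x - k x).
Proof.
move=> r1 cf df cf1 mf1 int1 intr dk ck1 k10 fkr; split => //.
exists (fun x => f1 x - k1 x).
  apply: (@weak_derivative_off_point _ x0).
  - move=> x; apply: continuousB; [exact: cf|exact: is_derive1_continuous (dk x)].
  - by move=> x xx0; apply: is_deriveB; exact: df.
  - by move=> x xx0; apply: continuousB; [exact: cf1|exact: ck1].
  - apply: open_integrable_locally; first exact: openT.
    exact: (integrableB measurableT int1 (integrable_compact_support ck1 k10)).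
by apply: in_LpB; [rewrite lee_fin|exact: in_Lp_powR|exact: in_Lp_compact_support ck1 k10 _].
Qed.

(** * Transfer of regularity from [u] to [g (u x)], with [g] of class C^1 on the range of [u] *)

Section composition.
Context {R : realType}.
Variables (Rm Rp x0 : R) (u u1 g g1 : R -> R).
Hypothesis uR : forall x, Rm <= u x <= Rp.
Hypothesis cu : continuous u.
Hypothesis du : forall x, x != x0 -> is_derive x 1 u (u1 x).
Hypothesis cu1 : forall x, x != x0 -> {for x, continuous u1}.
Hypothesis dg : forall x, Rm <= x <= Rp -> is_derive x 1 g (g1 x).
Hypothesis cg1 : forall x, Rm <= x <= Rp -> {for x, continuous g1}.

Let gu := fun x => g (u x).
Let gu1 := fun x => g1 (u x) * u1 x.

Lemma comp_continuous : continuous gu.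
Proof.
by apply: continuous_for => x; exact: continuous_at_comp (@cu x) (is_derive1_continuous (dg (uR x))).
Qed.

Lemma comp1_continuous : continuous (fun x => g1 (u x)).
Proof. by apply: continuous_for => x; exact: continuous_at_comp (@cu x) (cg1 (uR x)). Qed.

Lemma comp_is_derive x : x != x0 -> is_derive x 1 gu (gu1 x).
Proof. by move=> /du dux; exact: (@is_derive1_comp R g u x _ _ (dg (uR x)) dux). Qed.

Lemma comp_derive_continuous x : x != x0 -> {for x, continuous gu1}.
Proof. by move=> xx0; exact: continuousM (@comp1_continuous x) (cu1 xx0). Qed.

Lemma comp_in_Loo : in_Lp +oo gu.
Proof.
have [M _ gM] := C1_bounded_lipschitz dg cg1.
apply: (@in_Loo_bounded R M); first exact: continuous_measurable_fun comp_continuous.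
by move=> x; have [] := gM _ (uR x).
Qed.

Lemma comp_Holder_near (b C : R) :
  (forall x y, `|u x - u y| <= C * `|x - y| `^ b) -> Holder_near b x0 gu.
Proof.
move=> uC; have [M M0 gM] := C1_bounded_lipschitz dg cg1.
exists setT; first exact: filterT.
exists (M * C) => x y _ _; have [_ _ lip] := gM _ (uR x).
by apply: le_trans (lip _ (uR y)) _; rewrite -mulrA ler_wpM2l.
Qed.

Lemma comp_derive_integrable (r : R) : 0 <= r ->
  (@lebesgue_measure R).-integrable setT (fun x => (`|u1 x| `^ r)%:E) ->
  (@lebesgue_measure R).-integrable setT (fun x => (`|gu1 x| `^ r)%:E).
Proof.
move=> r0 intu; have [M M0 gM] := C1_bounded_lipschitz dg cg1.
apply: (@integrable_powR_mul R M) => //.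
  exact: measurable_off_point comp_derive_continuous.
by move=> x; have [] := gM _ (uR x).
Qed.

Lemma comp_derive_integrable1 :
  (@lebesgue_measure R).-integrable setT (fun x => (`|u1 x| `^ 1)%:E) ->
  (@lebesgue_measure R).-integrable setT (EFin \o gu1).
Proof.
move=> intu; apply: integrable_powR1; first exact: comp_derive_integrable.
exact: measurable_off_point comp_derive_continuous.
Qed.

Lemma comp_deriv_in_Lp (r : R) : 0 <= r ->
  (@lebesgue_measure R).-integrable setT (fun x => (`|u1 x| `^ 1)%:E) ->
  (@lebesgue_measure R).-integrable setT (fun x => (`|u1 x| `^ r)%:E) ->
  deriv_in_Lp r%:E gu.
Proof.
move=> r0 int1 intr.
apply: (deriv_in_Lp_off_point comp_continuous comp_is_derive comp_derive_continuous).
  exact: comp_derive_integrable1.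
exact: comp_derive_integrable.
Qed.

Variables (v v1 : R -> R) (a b : R).
Hypothesis vR : forall x, Rm <= v x <= Rp.
Hypothesis dv : forall x : R, is_derive x 1 v (v1 x).
Hypothesis cv1 : continuous v1.
Hypothesis v10 : forall x, ~~ (a <= x <= b) -> v1 x = 0.
Hypothesis intuv : (@lebesgue_measure R).-integrable setT (EFin \o (fun x => u x - v x)).

(** [g] is Lipschitz on [[Rm, Rp]], so the difference is dominated by the integrable [M * |u - v|].
    It is also bounded by [M * (Rp - Rm)], and interpolation gives every [p]. *)
Lemma comp_sub_in_Lp (p : \bar R) : (1 <= p)%E -> in_Lp p (fun x => gu x - g (v x)).
Proof.
have [M M0 gM] := C1_bounded_lipschitz dg cg1.
have cv : continuous v by move=> x; exact: is_derive1_continuous (dv x).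
have cgv : continuous (fun x => g (v x)).
  by apply: continuous_for => x; exact: continuous_at_comp (@cv x) (is_derive1_continuous (dg (vR x))).
have mh : measurable_fun setT (fun x => gu x - g (v x)).
  apply: continuous_measurable_fun; apply: continuous_for => x.
  exact: continuousB (@comp_continuous x) (@cgv x).
apply: (@in_Lp_bounded_integrable R (M * (Rp - Rm))).
- apply: (le_integrable_off_point (x0 := x0) (g := fun x => M * `|u x - v x|)) => //.
    by move=> x _; have [_ _] := gM _ (uR x); exact.
  by have := integrableZl measurableT M (integrable_norm intuv).
- move=> x; have [_ _ lip] := gM _ (uR x); apply: le_trans (lip _ (vR x)) _.
  rewrite ler_wpM2l//; have := uR x; have := vR x; rewrite ler_norml; lra.
Qed.

Lemma comp_sub_in_W1p (r : R) : 1 <= r ->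
  (@lebesgue_measure R).-integrable setT (fun x => (`|u1 x| `^ 1)%:E) ->
  (@lebesgue_measure R).-integrable setT (fun x => (`|u1 x| `^ r)%:E) ->
  in_W1p r%:E (fun x => gu x - g (v x)).
Proof.
move=> r1 int1 intr.
have cv : continuous v by move=> x; exact: is_derive1_continuous (dv x).
apply: (@in_W1p_sub R x0 r a b gu gu1 (fun x => g (v x)) (fun x => g1 (v x) * v1 x) r1).
- exact: comp_continuous.
- exact: comp_is_derive.
- exact: comp_derive_continuous.
- exact: measurable_off_point comp_derive_continuous.
- exact: comp_derive_integrable1.
- by apply: comp_derive_integrable => //; exact: le_trans r1.
- by move=> x; exact: (@is_derive1_comp R g v x _ _ (dg (vR x)) (dv x)).
- apply: continuous_for => x; have cg1v : {for x, continuous (fun y => g1 (v y))}.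
    exact: continuous_at_comp (@cv x) (cg1 (vR x)).
  exact: continuousM cg1v (@cv1 x).
- by move=> x /v10 ->; rewrite mulr0.
- by apply: comp_sub_in_Lp; rewrite lee_fin.
Qed.

End composition.

(** * The profile *)

Lemma open_pos (R : realType) : open (`]0, +oo[ : set R).
Proof. exact: interval_open. Qed.

Lemma velocity_C2 (R : realType) (c m : R) : C2_on `]0, +oo[ (velocity c m).
Proof.
have oP := @open_pos R.
exact: C2_onD oP (C2_on_cst _ oP) (C2_onM oP (C2_on_cst _ oP) (C2_on_inv R)).
Qed.

Lemma internal_energy_C2 (R : realType) (c m q k : R) :
  C2_on `]0, +oo[ (internal_energy c m q k).
Proof.
have oP := @open_pos R; have iP := C2_on_inv R.
rewrite (_ : internal_energy c m q k = fun r => (k - q * c + m / 2 * c ^+ 2) / m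
  + (m * c - q) * r^-1 + m ^+ 2 / 2 * (r^-1 * r^-1)); last first.
  by apply/funext => r; rewrite /internal_energy/= !invfM expr2; ring.
apply: (C2_onD oP); last exact: C2_onM oP (C2_on_cst _ oP) (C2_onM oP iP iP).
exact: C2_onD oP (C2_on_cst _ oP) (C2_onM oP (C2_on_cst _ oP) iP).
Qed.

Lemma total_energy_C2 (R : realType) (c m q k : R) :
  C2_on `]0, +oo[ (total_energy c m q k).
Proof.
have oP := @open_pos R; have idP := C2_on_id oP.
rewrite (_ : total_energy c m q k = fun r => r * internal_energy c m q k r
  + 2^-1 * r * (velocity c m r * velocity c m r)); last first.
  by apply/funext => r; rewrite /total_energy expr2.
have vP := velocity_C2 c m.
apply: (C2_onD oP); first exact: C2_onM oP idP (internal_energy_C2 c m q k).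
exact: C2_onM oP (C2_onM oP (C2_on_cst _ oP) idP) (C2_onM oP vP vP).
Qed.

Lemma stress_C2 (R : realType) (pt : R -> R -> R) (c m q k : R) :
  C2_on `]0, +oo[ (pressure pt c m q k) -> C2_on `]0, +oo[ (stress pt c m q k).
Proof.
move=> pP; have oP := @open_pos R; have iP := C2_on_inv R.
rewrite (_ : stress pt c m q k = fun r => q - m * c + - m ^+ 2 * r^-1
  + (- 1) * pressure pt c m q k r); last first.
  by apply/funext => r; rewrite /stress; ring.
apply: (C2_onD oP); last exact: C2_onM oP (C2_on_cst _ oP) pP.
exact: C2_onD oP (C2_on_cst _ oP) (C2_onM oP (C2_on_cst _ oP) iP).
Qed.

(** The momentum relation gives the pressure as [q - m * U]. Inserted in the energy relation, it
    identifies [internal_energy] at [r] with the energy of the end state; then [U = c + m / r] makes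
    the stress vanish. *)
Lemma stress_Rankine_Hugoniot (R : realType) (pt : R -> R -> R) (c m q k r U E : R) :
  0 < r -> m != 0 -> Rankine_Hugoniot pt c m q k r U E -> stress pt c m q k r = 0.
Proof.
move=> r0 m0 [mE qE kE]; have rn0 : r != 0 by rewrite gt_eqF.
have eE : internal_energy c m q k r = E / r - 2^-1 * U ^+ 2.
  have -> : E = r * (internal_energy c m q k r + 2^-1 * U ^+ 2); last by field.
  have pE : pt r (E / r - 2^-1 * U ^+ 2) = q - m * U by rewrite -qE; ring.
  apply: (mulfI m0); rewrite /internal_energy/=.
  move: kE; rewrite pE => <-.
  have -> : m = r * (U - c) by [].
  have rUc : r * (U - c) != 0 by rewrite mE.
  have Uc : U - c != 0 by apply: contraNneq rUc => ->; rewrite mulr0.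
  by field; rewrite rn0 Uc.
rewrite /stress /pressure eE.
have -> : pt r (E / r - 2^-1 * U ^+ 2) = q - m * U by rewrite -qE; ring.
by rewrite -mE; field.
Qed.

Lemma stress_derivatives (R : realType) (pt : R -> R -> R) (c m q k : R) :
  C2_on `]0, +oo[ (pressure pt c m q k) -> forall r, 0 < r ->
  let S1 := fun r => m ^+ 2 / r ^+ 2 - derive1 (pressure pt c m q k) r in
  let S2 := - (2 * m ^+ 2 / r ^+ 3 + derive1n 2 (pressure pt c m q k) r) in
  [/\ is_derive r 1 (stress pt c m q k) (S1 r), is_derive r 1 S1 S2,
      derive1 (stress pt c m q k) r = S1 r & derive1n 2 (stress pt c m q k) r = S2].
Proof.
move=> [C1p C1p'] r r0 S1 S2; set p := pressure pt c m q k.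
have dS (t : R) : 0 < t -> is_derive t 1 (stress pt c m q k) (S1 t).
  move=> t0; have tn0 : t != 0 by rewrite gt_eqF.
  have Pt : (`]0, +oo[ : set R) t by rewrite /= in_itv/= andbT.
  have dV := is_deriveZ (m ^+ 2) (is_deriveV tn0 (is_derive_id t 1)).
  have dp := is_derive_derive1 (C1p t Pt).1.
  apply: (is_derive_eq (is_deriveB (is_deriveB (is_derive_cst (q - m * c) t 1) dV) dp)).
  by rewrite /S1 /GRing.scale/= -/p; field.
have rn0 : r != 0 by rewrite gt_eqF.
have Pr : (`]0, +oo[ : set R) r by rewrite /= in_itv/= andbT.
have dS1 : is_derive r 1 S1 S2.
  have rr0 : r * r != 0 by rewrite mulf_neq0.
  have dr2 := is_deriveM (is_derive_id r 1) (is_derive_id r 1).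
  have dV := is_deriveZ (m ^+ 2) (is_deriveV (f := fun y => y * y) rr0 dr2).
  have dp := is_derive_derive1 (C1p' r Pr).1.
  apply: (is_derive_eq (is_deriveB dV dp)).
  by rewrite /S2 /GRing.scale/=; field.
split; [exact: dS|exact: dS1|exact: is_derive1_eq (dS r r0)|].
apply: is_derive1_eq; apply: near_eq_is_derive dS1.
have : nbhs r (`]0, +oo[ : set R) by exact: open_pos.
by apply: filterS => t; rewrite /= in_itv/= andbT => /dS/is_derive1_eq.
Qed.

(** With its counterpart on the right, this shows that the profile meets every density strictly
    between an end state and [Rs], so that [Rdot ^ 2 = Z] yields [Z >= 0] on the whole interval. *)
Lemma increasing_preimage_left (R : realType) (u : R -> R) (l x0 r : R) :
  continuous u -> {homo u : x y / x < y} -> u x @[x --> -oo] --> l -> l < r < u x0 ->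
  exists2 x, x < x0 & u x = r.
Proof.
move=> cu hu ul /andP[lr ru].
have [y /= [yr yx0]] : exists y : R, u y < r /\ y < x0.
  have nr : \forall y \near -oo, u y < r /\ y < x0.
    near=> y; split; near: y; first exact: (cvgr_lt _ ul _ lr).
    exact: nbhs_ninfty_lt (num_real x0).
  exact: filter_ex nr.
have cyx : {within `[y, x0], continuous u} by exact: continuous_subspaceT.
have uy := hu _ _ yx0.
have [|z zyx0 zr] := IVT (ltW yx0) cyx (v := r).
  by rewrite min_l ?max_r ?(ltW uy)// (ltW yr) (ltW ru).
exists z => //; rewrite lt_neqAle; move: zyx0; rewrite in_itv/= => /andP[_ ->]; rewrite andbT.
by apply: contraTneq ru => zx0; rewrite -zr zx0 ltxx.
Unshelve. all: by end_near. Qed.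

Lemma increasing_preimage_right (R : realType) (u : R -> R) (l x0 r : R) :
  continuous u -> {homo u : x y / x < y} -> u x @[x --> +oo] --> l -> u x0 < r < l ->
  exists2 x, x0 < x & u x = r.
Proof.
move=> cu hu ul /andP[ru rl].
have [y /= [yr yx0]] : exists y : R, r < u y /\ x0 < y.
  have nr : \forall y \near +oo, r < u y /\ x0 < y.
    near=> y; split; near: y; first exact: (cvgr_gt _ ul _ rl).
    exact: nbhs_pinfty_gt (num_real x0).
  exact: filter_ex nr.
have cyx : {within `[x0, y], continuous u} by exact: continuous_subspaceT.
have uy := hu _ _ yx0.
have [|z zyx0 zr] := IVT (ltW yx0) cyx (v := r).
  by rewrite min_l ?max_r ?(ltW uy)// (ltW yr) (ltW ru).
exists z => //; rewrite lt_neqAle; move: zyx0; rewrite in_itv/= => /andP[-> _]; rewrite andbT.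
by apply: contraTneq ru => zx0; rewrite -zr zx0 ltxx.
Unshelve. all: by end_near. Qed.

Lemma within_continuous_comp_sub (R : realType) (A B : set R) (f h : R -> R) :
  continuous f -> (forall x, A x -> B (f x)) -> {within B, continuous h} ->
  {within A, continuous (fun x => h (f x))}.
Proof.
move=> cf AB /subspace_continuousP ch; apply/subspace_continuousP => x Ax.
apply: (@cvg_comp _ _ _ f h _ (within B (nbhs (f x)))); last exact: ch (AB x Ax).
move=> W nW; have nW' : nbhs x (fun t => B (f t) -> W (f t)) := cf x _ nW.
by apply: filterS nW' => t /= H At; apply: H; exact: AB.
Qed.

Lemma nbhs_lipschitz_ball (R : realType) (f : R -> R) (x : R) :
  (exists2 N, nbhs x N & [lipschitz f y | y in N]) ->
  exists d Lip : R, [/\ 0 < d, 0 <= Lip &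
    forall y, `|y - x| < d -> `|f y - f x| <= Lip * `|y - x|].
Proof.
move=> [N xN [M [_ lip]]]; have [d /= d0 dN] := xN.
(* The Lipschitz property provides every constant larger than [M], which may be negative; [|M| + 1]
   is one that is nonnegative. *)
exists d, (`|M| + 1); split => //.
move=> y yd; have Ny : N y by apply: dN; rewrite /ball_/= distrC.
have := lip (`|M| + 1); rewrite (le_lt_trans (ler_norm M)) ?ltrDl// => /(_ isT (y, x)).
by apply; split => //=; exact: nbhs_singleton.
Qed.

(** The exponent is [2 p2 / (t + p2)] with [t = 2 m ^ 2 / Rs ^ 3 > 0] and [p2 >= 0]. The last clause
    is [a_s <= a] with the denominator cleared, the form that [one_sided_bounds] takes. *)
Lemma sonic_exponent_bounds (R : realType) (pt : R -> R -> R) (c m q k Rs : R) :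
  m != 0 -> 0 < Rs -> C2_on `]0, +oo[ (pressure pt c m q k) ->
  0 <= derive1n 2 (pressure pt c m q k) Rs ->
  [/\ 0 <= sonic_exponent pt c m q k Rs, sonic_exponent pt c m q k Rs < 2 &
      forall a, sonic_exponent pt c m q k Rs <= a ->
        2 * derive1n 2 (pressure pt c m q k) Rs
          <= a * (2 * m ^+ 2 / Rs ^+ 3 + derive1n 2 (pressure pt c m q k) Rs)].
Proof.
move=> m0 Rs0 pP; have [_ _ _ S2E] := stress_derivatives pP Rs0.
rewrite /sonic_exponent {}S2E; move: (derive1n 2 _ Rs) => p2 p20.
have t0 : 0 < 2 * m ^+ 2 / Rs ^+ 3.
  by rewrite divr_gt0 ?exprn_gt0// mulr_gt0// exprn_even_gt0.
move: (2 * m ^+ 2 / Rs ^+ 3) t0 => t t0.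
have tp0 : 0 < t + p2 by rewrite ltr_wpDr.
rewrite invrN mulrN opprK; split.
- by rewrite divr_ge0 ?mulr_ge0// ltW.
- by rewrite ltr_pdivrMr//; lra.
- by move=> a; rewrite ler_pdivrMr.
Qed.

Lemma canonical_bounds (R : realType) (pt : R -> R -> R) (al c m q k s L Rs a : R)
    (Z : R -> R) :
  s = 1 \/ s = -1 -> 0 < L -> 0 < Rs -> 0 < Rs + s * L -> 0 < al -> m != 0 ->
  C2_on `]0, +oo[ (pressure pt c m q k) ->
  (forall r : R, 0 < r -> 0 <= derive1n 2 (pressure pt c m q k) r) ->
  derive1 (stress pt c m q k) Rs = 0 -> stress pt c m q k (Rs + s * L) = 0 ->
  (exists2 N, nbhs Rs N & [lipschitz derive1n 2 (pressure pt c m q k) x | x in N]) ->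
  (forall d : R, 0 < d < L -> [/\ derivable Z (Rs + s * d) 1,
    Z_ode pt al c m q k Z (Rs + s * d) & 0 <= Z (Rs + s * d)]) ->
  {within `]0, L], continuous (fun d : R => Z (Rs + s * d))} -> Z (Rs + s * L) = 0 ->
  0 < a -> sonic_exponent pt c m q k Rs <= a ->
  (exists2 K : R, 0 < K & forall d : R, 0 < d < L -> K * (L - d) ^+ 2 <= Z (Rs + s * d)) /\
  (exists C : R, forall d : R, 0 < d < L -> d `^ a * Z (Rs + s * d) <= C).
Proof.
move=> s1 L0 Rs0 Re0 al0 m0 pP p20 S1Rs SRe lip hZ cZ ZL a0 aE.
have [d0 [Lip [d00 Lip0 lipE]]] := nbhs_lipschitz_ball lip.
(* Inside the ball where [p''] is Lipschitz at [Rs], and strictly below [L]. *)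
pose delta := Num.min d0 (L / 2).
have s2 : s ^+ 2 = 1 by case: s1 => ->; ring.
have sn : `|s| = 1 by case: s1 => ->; rewrite ?normrN normr1.
have de0 : 0 < delta < L.
  by rewrite lt_min d00 divr_gt0//= gt_min ltr_pdivrMr// ltr_pMr// ltr1n orbT.
pose S1 r := m ^+ 2 / r ^+ 2 - derive1 (pressure pt c m q k) r.
have S1E r : 0 < r -> derive1 (stress pt c m q k) r = S1 r.
  by move=> r0; have [] := stress_derivatives pP r0.
have side (d : R) : 0 <= d <= L -> Num.min Rs (Rs + s * L) <= Rs + s * d <= Num.max Rs (Rs + s * L).
  move=> /andP[d_ge dL]; rewrite ge_min le_max.
  by case: s1 => ->; apply/andP; split; apply/orP; [left|right|right|left]; lra.
have b0 : 0 < Num.min Rs (Rs + s * L) by rewrite lt_min Rs0.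
have dS (r : R) : 0 < r -> is_derive r 1 (stress pt c m q k) (S1 r).
  by move=> r0; have [dSr _ _ _] := stress_derivatives pP r0; exact: dSr.
have dS1 (r : R) : 0 < r ->
    is_derive r 1 S1 (- (2 * m ^+ 2 / r ^+ 3 + derive1n 2 (pressure pt c m q k) r)).
  by move=> r0; have [_ dS1r _ _] := stress_derivatives pP r0; exact: dS1r.
have S1Rs0 : S1 Rs = 0 by rewrite -S1E.
have dZ (d : R) : 0 < d < L -> is_derive (Rs + s * d) 1 Z
    (2 / al * (stress pt c m q k (Rs + s * d) / S1 (Rs + s * d))
     - (- (2 / (Rs + s * d))
        - 2 * derive1n 2 (pressure pt c m q k) (Rs + s * d) / S1 (Rs + s * d)) * Z (Rs + s * d)).
  move=> dL; have [dZd ode _] := hZ d dL.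
  have r0 : 0 < Rs + s * d.
    have /side/andP[+ _] : 0 <= d <= L by case/andP: dL => /ltW -> /ltW ->.
    exact: lt_le_trans.
  apply: (is_derive_eq (is_derive_derive1 dZd)).
  by move: ode; rewrite /Z_ode (S1E _ r0) => <-; rewrite addrK.
have Z0 (d : R) : 0 < d < L -> 0 <= Z (Rs + s * d) by move=> /hZ[_ _ Zd]; exact: Zd.
have p2Lip (d : R) : 0 < d < delta ->
    `|derive1n 2 (pressure pt c m q k) (Rs + s * d) - derive1n 2 (pressure pt c m q k) Rs| <= Lip * d.
  move=> /andP[d_gt dde]; have nd : `|Rs + s * d - Rs| = d.
    by rewrite addrAC subrr add0r normrM sn mul1r gtr0_norm.
  by rewrite -{2}nd; apply: lipE; rewrite nd (lt_le_trans dde)// ge_min lexx.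
have [_ _ /(_ a aE) aE'] := sonic_exponent_bounds m0 Rs0 pP (p20 _ Rs0).
exact: (one_sided_bounds s2 de0 b0 al0 m0 Lip0 side dS dS1 p20 S1Rs0 SRe dZ Z0 cZ ZL p2Lip a0 aE').
Qed.

(** Passage from the bounds on [Z = Rdot ^ 2] to bounds on [Rdot]; the weight [D ^ a] becomes
    [D ^ (a / 2)]. *)
Lemma sqr_bounds (R : realType) (K C a D e y : R) : 0 <= K -> 0 <= D -> 0 <= y ->
  K * e ^+ 2 <= y ^+ 2 -> D `^ a * y ^+ 2 <= C ->
  Num.sqrt K * e <= y /\ D `^ (a / 2) * y <= Num.sqrt C.
Proof.
move=> K0 D0 y0 Ke DC; split.
  have [e0|/ltW e0] := leP 0 e; last first.
    by apply: le_trans y0; rewrite mulr_ge0_le0 ?sqrtr_ge0.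
  rewrite -(@ler_pXn2r _ 2) ?nnegrE ?mulr_ge0 ?sqrtr_ge0//.
  by rewrite exprMn sqr_sqrtr.
have C0 : 0 <= C by apply: le_trans DC; rewrite mulr_ge0 ?powR_ge0 ?sqr_ge0.
rewrite -(@ler_pXn2r _ 2) ?nnegrE ?mulr_ge0 ?powR_ge0 ?sqrtr_ge0//.
by rewrite exprMn sqr_sqrtr// -powR_mulrn ?powR_ge0// -powRrM mulfVK.
Qed.

Lemma Omega_setC1 (R : realType) (x0 : R) :
  (`]-oo, x0[ `|` `]x0, +oo[ : set R) = [set~ x0].
Proof.
apply/seteqP; split => x /=; rewrite !in_itv/= andbT.
  by move=> [] xx0 xE; rewrite xE ltxx in xx0.
by move=> /eqP; rewrite neq_lt => /orP[]; [left|right].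
Qed.

Lemma increasing_derive1_ge0 (R : realType) (x0 : R) (u : R -> R) :
  C1_on [set~ x0] u -> {homo u : x y / x < y} ->
  forall x, x != x0 -> 0 <= derive1 u x.
Proof.
move=> C1u hu x /eqP xx0; apply: (@incr_derive1_ge0 R u [set~ x0] x).
- by move=> y /set_mem/interior_subset yx0; exact: (C1u y yx0).1.
- by move=> y z _ _; exact: hu.
- by have := @open_setC1 R x0; rewrite openE => /(_ x xx0).
Qed.

Lemma profile_bounds (R : realType) (alpha : R) (pt : R -> R -> R) (c m q k : R)
    (Rm Rp Rs : R) (Zm Zp : R -> R) (xis : R) (Rf : R -> R) (a : R) :
  0 < alpha -> m != 0 -> 0 < Rm -> 0 < Rp ->
  stress pt c m q k Rm = 0 -> stress pt c m q k Rp = 0 ->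
  C2_on `]0, +oo[ (pressure pt c m q k) ->
  (forall rho, 0 < rho -> 0 <= derive1n 2 (pressure pt c m q k) rho) ->
  sonic_density pt c m q k Rm Rp Rs ->
  (exists2 N, nbhs Rs N & [lipschitz derive1n 2 (pressure pt c m q k) x | x in N]) ->
  canonical_left pt alpha c m q k Rm Rs Zm ->
  canonical_right pt alpha c m q k Rs Rp Zp ->
  global_profile pt alpha c m q k Rm Rp Rs Zm Zp xis Rf ->
  0 < a -> sonic_exponent pt c m q k Rs <= a ->
  (exists2 K : R, 0 < K & forall x,
     (x < xis -> K * (Rf x - Rm) <= derive1 Rf x) /\
     (xis < x -> K * (Rp - Rf x) <= derive1 Rf x)) /\
  (exists K : R, forall x, x != xis -> `|Rf x - Rs| `^ (a / 2) * derive1 Rf x <= K).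
Proof.
move=> al0 m0 Rm0 Rp0 SRm SRp pP p20 [/andP[RmRs RsRp] S1Rs _] lip.
move=> [C1Zm cZm odeZm ZRm] [C1Zp cZp odeZp ZRp].
move=> [[Rf_in cRf Rf_incr Rf_xis] [C2Rf dRfm dRfp] [Rf_ny Rf_y _ _] _ _] a0 aE.
have Rs0 : 0 < Rs by exact: lt_trans RmRs.
have u'0 x : x != xis -> 0 <= derive1 Rf x.
  by apply: increasing_derive1_ge0 => //; case: C2Rf; rewrite Omega_setC1.
have EL : Rs + -1 * (Rs - Rm) = Rm by ring.
have ER : Rs + 1 * (Rp - Rs) = Rp by ring.
have L0 : 0 < Rs - Rm by rewrite subr_gt0.
have R0 : 0 < Rp - Rs by rewrite subr_gt0.
have [[k1 k10 k1E] [C1 C1E]] : (exists2 K : R, 0 < K & forall d : R, 0 < d < Rs - Rm ->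
      K * (Rs - Rm - d) ^+ 2 <= Zm (Rs + -1 * d)) /\
    (exists C : R, forall d : R, 0 < d < Rs - Rm -> d `^ a * Zm (Rs + -1 * d) <= C).
  have rin (d : R) : 0 < d < Rs - Rm -> Rm < Rs + -1 * d < Rs.
    by move=> /andP[d0 dL]; apply/andP; split; lra.
  apply: (@canonical_bounds R pt alpha c m q k (-1) (Rs - Rm) Rs a Zm); rewrite ?EL//.
  - by right.
  - move=> d /rin rin_d; split; [|exact: odeZm|].
      by apply: (C1Zm _ _).1; rewrite /= in_itv.
    (* [Zm] is nonnegative at this density because the profile attains it at some [x < xis], where
       [Zm] is the square of [Rdot]. *)
    have rin' : Rm < Rs + -1 * d < Rf xis by rewrite Rf_xis.
    have [x xx <-] := increasing_preimage_left cRf Rf_incr Rf_ny rin'.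
    by rewrite -dRfm// sqr_ge0.
  - apply: (within_continuous_comp_sub (B := `[Rm, Rs[) _ _ cZm).
      move=> x; apply: is_derive1_continuous (is_deriveD (is_derive_cst Rs x 1) (is_deriveZ (-1) (is_derive_id x 1))).
    move=> x /=; rewrite !in_itv/= => /andP[x0 xL]; apply/andP; split; lra.
have [[k2 k20 k2E] [C2 C2E]] : (exists2 K : R, 0 < K & forall d : R, 0 < d < Rp - Rs ->
      K * (Rp - Rs - d) ^+ 2 <= Zp (Rs + 1 * d)) /\
    (exists C : R, forall d : R, 0 < d < Rp - Rs -> d `^ a * Zp (Rs + 1 * d) <= C).
  have rin (d : R) : 0 < d < Rp - Rs -> Rs < Rs + 1 * d < Rp.
    by move=> /andP[d0 dL]; apply/andP; split; lra.
  apply: (@canonical_bounds R pt alpha c m q k 1 (Rp - Rs) Rs a Zp); rewrite ?ER//.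
  - by left.
  - move=> d /rin rin_d; split; [|exact: odeZp|].
      by apply: (C1Zp _ _).1; rewrite /= in_itv.
    have rin' : Rf xis < Rs + 1 * d < Rp by rewrite Rf_xis.
    have [x xx <-] := increasing_preimage_right cRf Rf_incr Rf_y rin'.
    by rewrite -dRfp// sqr_ge0.
  - apply: (within_continuous_comp_sub (B := `]Rs, Rp]) _ _ cZp).
      move=> x; apply: is_derive1_continuous (is_deriveD (is_derive_cst Rs x 1) (is_deriveZ 1 (is_derive_id x 1))).
    move=> x /=; rewrite !in_itv/= => /andP[x0 xL]; apply/andP; split; lra.
have left_side x : x < xis -> Num.sqrt k1 * (Rf x - Rm) <= derive1 Rf x /\
    `|Rf x - Rs| `^ (a / 2) * derive1 Rf x <= Num.sqrt C1.
  move=> xx; have := Rf_incr _ _ xx; rewrite Rf_xis => RfRs.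
  have /andP[RmRf _] := Rf_in x.
  have dL : 0 < Rs - Rf x < Rs - Rm by rewrite subr_gt0 RfRs ltrD2l ltrN2.
  have E1 : Rs + -1 * (Rs - Rf x) = Rf x by ring.
  have E2 : Rs - Rm - (Rs - Rf x) = Rf x - Rm by ring.
  have D0 : 0 <= Rs - Rf x by rewrite subr_ge0 ltW.
  have := k1E _ dL; have := C1E _ dL; rewrite E1 E2 -dRfm// => DC Ke.
  rewrite distrC (ger0_norm D0); apply: sqr_bounds => //; first exact: ltW.
  by apply: u'0; rewrite lt_eqF.
have right_side x : xis < x -> Num.sqrt k2 * (Rp - Rf x) <= derive1 Rf x /\
    `|Rf x - Rs| `^ (a / 2) * derive1 Rf x <= Num.sqrt C2.
  move=> xx; have := Rf_incr _ _ xx; rewrite Rf_xis => RfRs.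
  have /andP[_ RfRp] := Rf_in x.
  have dL : 0 < Rf x - Rs < Rp - Rs by rewrite subr_gt0 RfRs ltrD2r.
  have E1 : Rs + 1 * (Rf x - Rs) = Rf x by ring.
  have E2 : Rp - Rs - (Rf x - Rs) = Rp - Rf x by ring.
  have D0 : 0 <= Rf x - Rs by rewrite subr_ge0 ltW.
  have := k2E _ dL; have := C2E _ dL; rewrite E1 E2 -dRfp// => DC Ke.
  rewrite (ger0_norm D0); apply: sqr_bounds => //; first exact: ltW.
  by apply: u'0; rewrite gt_eqF.
split.
  exists (Num.min (Num.sqrt k1) (Num.sqrt k2)); first by rewrite lt_min !sqrtr_gt0 k10.
  move=> x; have /andP[/ltW RmRf /ltW RfRp] := Rf_in x; split=> xx.
    have [le _] := left_side x xx; apply: le_trans le.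
    by rewrite ler_wpM2r ?subr_ge0// ge_min lexx.
  have [le _] := right_side x xx; apply: le_trans le.
  by rewrite ler_wpM2r ?subr_ge0// ge_min lexx orbT.
exists (Num.max (Num.sqrt C1) (Num.sqrt C2)) => x; rewrite neq_lt => /orP[] xx.
  have [_ le] := left_side x xx; apply: le_trans le _; by rewrite le_max lexx.
have [_ le] := right_side x xx; apply: le_trans le _; by rewrite le_max lexx orbT.
Qed.

(** Outside [[x0 - 1, x0 + 1]] the interpolant is the end state, and the distance to it is at most
    [K^-1 * |u'|]; inside, the difference is at most [Rp - Rm]. The dominating function is the sum
    of these two. *)
Lemma sub_interpolant_integrable (R : realType) (Rm Rp x0 K : R) (u v : R -> R) :
  continuous u -> continuous v -> (forall x, Rm <= u x <= Rp) ->
  interpolant Rm Rp x0 v -> 0 < K ->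
  (forall x, (x < x0 -> K * (u x - Rm) <= derive1 u x) /\
             (x0 < x -> K * (Rp - u x) <= derive1 u x)) ->
  (@lebesgue_measure R).-integrable setT (EFin \o derive1 u) ->
  (@lebesgue_measure R).-integrable setT (EFin \o (fun x => u x - v x)).
Proof.
move=> cu cv uR [_ vR vm vp] K0 uK intu.
pose I := (fun=> Rp - Rm) \_ (`[x0 - 1, x0 + 1] : set R).
have intI : (@lebesgue_measure R).-integrable setT (EFin \o I).
  rewrite /I -restrict_EFin; apply/integrable_restrict => //=; rewrite setTI.
  apply: continuous_compact_integrable; first exact: segment_compact.
  by apply: continuous_subspaceT => x; exact: cst_continuous.
have intu' := integrableZl measurableT K^-1 (integrable_norm intu).
apply: (le_integrable_off_point (x0 := x0) (g := fun x => K^-1 * `|derive1 u x| + I x)).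
- apply: continuous_measurable_fun => x; exact: continuousB (@cu x) (@cv x).
- move=> x xx0; have /andP[u1 u2] := uR x; have /andP[v1 v2] := vR x.
  have I0 : 0 <= I x.
    by rewrite /I patchE; case: ifP => // _; rewrite subr_ge0 (le_trans u1).
  have K'0 : 0 <= K^-1 * `|derive1 u x| by rewrite mulr_ge0 ?invr_ge0// ltW.
  have [xl|xl] := leP x (x0 - 1).
    rewrite vm// ger0_norm ?subr_ge0//.
    have xx : x < x0 by apply: le_lt_trans xl _; rewrite ltrBlDr ltrDl.
    have le := (uK x).1 xx.
    rewrite -[leLHS]addr0; apply: lerD => //.
    by rewrite ler_pdivlMl// (le_trans le)// ler_norm.
  have [xr|xr] := leP (x0 + 1) x.
    rewrite vp// ler0_norm ?subr_le0// opprB.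
    have xx : x0 < x by apply: lt_le_trans xr; rewrite ltrDl.
    have le := (uK x).2 xx.
    rewrite -[leLHS]addr0; apply: lerD => //.
    by rewrite ler_pdivlMl// (le_trans le)// ler_norm.
  have IE : I x = Rp - Rm.
    by rewrite /I patchE mem_set//= in_itv/= !ltW.
  rewrite IE -[leLHS]add0r; apply: lerD => //.
  by rewrite ler_norml; lra.
- by have := integrableD measurableT intu' intI.
Qed.

Lemma interpolant_derivative (R : realType) (Rm Rp x0 : R) (v : R -> R) :
  interpolant Rm Rp x0 v -> [/\ forall x, Rm <= v x <= Rp,
    forall x : R, is_derive x 1 v (derive1 v x), continuous (derive1 v)
    & forall x, ~~ (x0 - 1 <= x <= x0 + 1) -> derive1 v x = 0].
Proof.
move=> [sv vR vm vp]; split => //.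
- by move=> x; apply: is_derive_derive1; exact: (sv 0%N).
- by move=> x; apply: derivable1_continuous; exact: (sv 1%N).
- move=> x; rewrite negb_and -!ltNge => /orP[] xx; apply: is_derive1_eq.
    apply: near_eq_is_derive (is_derive_cst Rm x 1); near=> y; rewrite vm//.
    by apply/ltW; near: y; exact: lt_nbhsl.
  apply: near_eq_is_derive (is_derive_cst Rp x 1); near=> y; rewrite vp//.
  by apply/ltW; near: y; exact: lt_nbhsr.
Unshelve. all: by end_near. Qed.

(** All regularity claims for a single [g], so that the density (with [g] the identity), the
    velocity, the two energies and the stress are five instances. *)
Lemma composition_regularity (R : realType) (Rm Rp x0 as_ : R) (u u1 g : R -> R) :
  0 < Rm -> (forall x, Rm <= u x <= Rp) -> continuous u ->
  (forall x, x != x0 -> is_derive x 1 u (u1 x)) ->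
  (forall x, x != x0 -> {for x, continuous u1}) ->
  (forall r, 1 <= r -> admissible as_ r ->
    (@lebesgue_measure R).-integrable setT (fun x => (`|u1 x| `^ r)%:E)) ->
  admissible as_ 1 ->
  (forall v, interpolant Rm Rp x0 v ->
    (@lebesgue_measure R).-integrable setT (EFin \o (fun x => u x - v x))) ->
  C2_on `]0, +oo[ g ->
  [/\ forall b C, (forall x y, `|u x - u y| <= C * `|x - y| `^ b) ->
        Holder_near b x0 (fun x => g (u x)),
      in_Lp +oo (fun x => g (u x)),
      forall v, interpolant Rm Rp x0 v -> forall p : \bar R, (1 <= p)%E ->
        in_Lp p (fun x => g (u x) - g (v x)),
      forall r, admissible as_ r -> deriv_in_Lp r%:E (fun x => g (u x)) &
      forall v, interpolant Rm Rp x0 v -> forall r, admissible as_ r ->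
        in_W1p r%:E (fun x => g (u x) - g (v x))].
Proof.
move=> Rm0 uR cu du cu1 intu adm1 intuv /(C2_onP _ (@open_pos R))[g1 [g2 gP]].
have pos x : Rm <= x <= Rp -> (`]0, +oo[ : set R) x.
  by move=> /andP[Rmx _]; rewrite /= in_itv/= andbT (lt_le_trans Rm0).
have dg x : Rm <= x <= Rp -> is_derive x 1 g (g1 x) by move=> /pos/gP[].
have cg1 x : Rm <= x <= Rp -> {for x, continuous g1}.
  by move=> /pos/gP[_ dg1 _]; exact: is_derive1_continuous dg1.
have adm_ge1 r : admissible as_ r -> 1 <= r by case=> [[_ /andP[]]|[]].
have int1 := intu 1 (lexx 1) adm1.
split.
- by move=> b C uC; exact: (comp_Holder_near x0 uR dg cg1 uC).
- exact: (comp_in_Loo uR cu dg cg1).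
- move=> v hv p p1; have [vR dv cv1 v10] := interpolant_derivative hv.
  exact: (comp_sub_in_Lp x0 uR cu dg cg1 vR dv (intuv v hv) p1).
- move=> r admr; have r1 := adm_ge1 r admr.
  exact: (comp_deriv_in_Lp uR cu du cu1 dg cg1 (le_trans ler01 r1) int1 (intu r r1 admr)).
- move=> v hv r admr; have [vR dv cv1 v10] := interpolant_derivative hv.
  have r1 := adm_ge1 r admr.
  exact: (comp_sub_in_W1p uR cu du cu1 dg cg1 vR dv cv1 v10 (intuv v hv) r1 int1 (intu r r1 admr)).
Qed.

(** * The traveling-wave system in weak form *)

Lemma dist_deriv_affine (R : realType) (k K : R) (f phi : R -> R) :
  continuous f -> test_function phi ->
  dist_deriv (fun x => k * f x + K) phi = k * dist_deriv f phi.
Proof.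
move=> cf tphi; have [smphi _] := tphi.
have cphi' : continuous (derive1 phi).
  by move=> x; apply: derivable1_continuous; exact: (smphi 1%N).
have [M M0 phi0] := test_function_bounded_support tphi.
have out x : ~~ (- M <= x <= M) -> derive1 phi x = 0.
  by move=> xM; have [|_ ->] := phi0 x; rewrite // ltNge ler_norml.
have int1 : (@lebesgue_measure R).-integrable setT (EFin \o (fun x => f x * derive1 phi x)).
  apply: (@integrable_compact_support R (- M) M) => [x|x /out ->]; last by rewrite mulr0.
  exact: continuousM (@cf x) (@cphi' x).
have int2 : (@lebesgue_measure R).-integrable setT (EFin \o derive1 phi).
  exact: integrable_compact_support cphi' out.
(* The additive constant drops out because [phi'] has zero integral, read here as the statement that
   the constant [1] has weak derivative [0]. *)
have phi'0 : \int[@lebesgue_measure R]_x derive1 phi x = 0.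
  have [_ _ /(_ phi tphi)] : weak_derivative (fun=> 1 : R) (fun=> 0).
    apply: (@weak_derivative_off_point _ 0) => [x|x _|]; try exact: cst_continuous.
    by apply: continuous_locally_integrable => x; exact: cst_continuous.
  rewrite /dist_deriv.
  under eq_Rintegral do rewrite mul1r.
  under [in RHS]eq_Rintegral do rewrite mul0r.
  by rewrite Rintegral_cst//= mul0r => /eqP; rewrite oppr_eq0 => /eqP.
rewrite /dist_deriv mulrN; congr (- _).
transitivity (\int[@lebesgue_measure R]_x (k * (f x * derive1 phi x) + K * derive1 phi x)).
  by apply: eq_Rintegral => x _; ring.
rewrite RintegralD//; [|by have := integrableZl measurableT k int1|by have := integrableZl measurableT K int2].
by rewrite !RintegralZl// phi'0 mulr0 addr0.
Qed.

Lemma eq_Rintegral_off_point (R : realType) (x0 : R) (f g : R -> R) :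
  measurable_fun setT f -> measurable_fun setT g -> (forall x, x != x0 -> f x = g x) ->
  \int[@lebesgue_measure R]_x f x = \int[@lebesgue_measure R]_x g x.
Proof.
move=> mf mg fg; rewrite /Rintegral; congr fine.
have mT : measurable (setT `\ x0) by apply: measurableD => //; exact: measurable_set1.
rewrite -(@integral_setD1 _ _ x0 setT)//; last by apply: measurable_funTS; exact/measurable_EFinP.
rewrite -[RHS](@integral_setD1 _ _ x0 setT)//; last by apply: measurable_funTS; exact/measurable_EFinP.
by apply: eq_integral => x /set_mem/= [_ /eqP xx0]; rewrite fg.
Qed.

(** By the chain rule off [x0], the weak stress equation is the weak profile equation with its two
    integrals exchanged: [U' ^ 2] becomes [m ^ 2 / u ^ 4 * u' ^ 2], and [S'] becomes [SR * u']. *)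
Lemma stress_balance_eq (R : realType) (x0 alpha m : R)
    (u u' U' S S' SR phi phi' : R -> R) :
  measurable_fun setT (fun x => (u x)^-1) -> measurable_fun setT u' -> measurable_fun setT U' ->
  measurable_fun setT S -> measurable_fun setT S' -> measurable_fun setT SR ->
  measurable_fun setT phi -> measurable_fun setT phi' -> (forall x, u x != 0) ->
  (forall x, x != x0 -> U' x = - (m / u x ^+ 2) * u' x) ->
  (forall x, x != x0 -> S' x = SR x * u' x) ->
  \int[@lebesgue_measure R]_x (((u x)^-1 * S x - 2 * alpha * U' x ^+ 2) * phi x) +
  \int[@lebesgue_measure R]_x (alpha * (u x)^-1 * S' x * phi' x) =
  \int[@lebesgue_measure R]_x (alpha * (SR x / u x) * u' x * phi' x) +
  \int[@lebesgue_measure R]_x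
    ((S x / u x - 2 * alpha * (m ^+ 2 / u x ^+ 4) * u' x ^+ 2) * phi x).
Proof.
move=> mV mu' mU mS mS' mSR mphi mphi' u0 UE SE.
have mcst (a : R) : measurable_fun setT (fun _ : R => a) by exact: measurable_cst.
rewrite addrC; congr (_ + _); apply: (@eq_Rintegral_off_point _ x0).
- by apply: measurable_funM => //; apply: measurable_funM => //; exact: measurable_funM.
- apply: measurable_funM => //; apply: measurable_funM => //; apply: measurable_funM => //.
  exact: measurable_funM.
- by move=> x xx0; rewrite SE//; ring.
- apply: measurable_funM => //; apply: measurable_funB; first exact: measurable_funM.
  by apply: measurable_funM => //; exact: measurable_funX.
- apply: measurable_funM => //; apply: measurable_funB; first exact: measurable_funM.
  apply: measurable_funM; last exact: measurable_funX.
  apply: measurable_funM => //; apply: measurable_funM => //.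
  rewrite (_ : (fun x => (u x ^+ 4)^-1) = (fun x => (u x)^-1 ^+ 4)); last first.
    by apply/funext => x; rewrite exprVn.
  exact: measurable_funX.
- by move=> x xx0; rewrite UE//; field; exact: u0.
Qed.

Lemma weak_solution_of_profile (R : realType) (pt : R -> R -> R) (alpha c m q k : R)
    (Rm Rp x0 : R) (Rf : R -> R) :
  m != 0 -> 0 < Rm -> (forall x, Rm <= Rf x <= Rp) -> continuous Rf ->
  C1_on [set~ x0] Rf -> C2_on `]0, +oo[ (stress pt c m q k) ->
  let U := fun x => velocity c m (Rf x) in
  let S := fun x => stress pt c m q k (Rf x) in
  deriv_in_Lp 1%:E U -> deriv_in_Lp 2%:E U -> deriv_in_Lp 1%:E S ->
  profile_weak_equation pt alpha c m q k Rf ->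
  weak_solution pt alpha c Rf U (fun x => total_energy c m q k (Rf x))
    (fun x => internal_energy c m q k (Rf x)) S.
Proof.
move=> m0 Rm0 RfR cRf C1Rf SP U S U1 U2 S1 weq.
have Rf0 x : 0 < Rf x by have /andP[+ _] := RfR x; exact: lt_le_trans.
have Rfn0 x : Rf x != 0 by rewrite gt_eqF.
have P x : (`]0, +oo[ : set R) (Rf x) by rewrite /= in_itv/= andbT.
have cont_comp g : C2_on `]0, +oo[ g -> continuous (fun x => g (Rf x)).
  move=> /(C2_onP _ (@open_pos R))[g1 [g2 gP]]; apply: continuous_for => x.
  have [dg _ _] := gP _ (P x).
  exact: continuous_at_comp (@cRf x) (is_derive1_continuous dg).
have cU : continuous U := cont_comp _ (velocity_C2 c m).
have cS : continuous S := cont_comp _ SP.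
have cE := cont_comp _ (total_energy_C2 c m q k).
have cV : continuous (fun x => (Rf x)^-1) := cont_comp _ (C2_on_inv R).
have cRU : continuous (fun x => Rf x * U x).
  by apply: continuous_for => x; exact: continuousM (@cRf x) (@cU x).
(* In each conservation law the flux is an affine function of the density. *)
have RUE : (fun x => Rf x * U x) = (fun x => c * Rf x + m).
  by apply/funext => x; rewrite /U /velocity; field; exact: Rfn0.
have momE : (fun x => Rf x * U x ^+ 2 + pt (Rf x) (internal_energy c m q k (Rf x)) + S x)
    = (fun x => c * (Rf x * U x) + q).
  apply/funext => x; rewrite /S /stress /pressure /U /velocity.
  by field; exact: Rfn0.
have fluxE : (fun x => (total_energy c m q k (Rf x)
    + pt (Rf x) (internal_energy c m q k (Rf x)) + S x) * U x)
    = (fun x => c * total_energy c m q k (Rf x) + k).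
  apply/funext => x; rewrite /S /stress /pressure /U /total_energy.
  set p := pt _ _; rewrite /internal_energy /velocity/=.
  by field; rewrite m0 Rfn0.
have affine_continuous (h : R -> R) (a : R) : continuous h -> continuous (fun x => c * h x + a).
  move=> ch; apply: continuous_for => x.
  exact: continuousD (continuousM (@cst_continuous _ _ c x) (@ch x)) (@cst_continuous _ _ a x).
have transport (h : R -> R) (a : R) : continuous h -> forall phi, test_function phi ->
    - c * dist_deriv h phi + dist_deriv (fun x => c * h x + a) phi = 0.
  by move=> ch phi tphi; rewrite dist_deriv_affine// mulNr addNr.
have [wU /andP[mU1 _]] := U1; have [wS inS1] := S1.
have mU : measurable_fun setT (derive1 U) by rewrite inE in mU1.
have intS : (@lebesgue_measure R).-integrable setT (EFin \o derive1 S).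
  exact/Lfun1_integrable.
have mS : measurable_fun setT (derive1 S) by have /measurable_int/measurable_EFinP := intS.
(* The only place where [Udot] must be square integrable, hence the hypothesis with exponent [2]. *)
have intU2 : (@lebesgue_measure R).-integrable setT (EFin \o (fun x => derive1 U x ^+ 2)).
  by apply: Lfun2_integrable_sqr; case: U2.
have mV : measurable_fun setT (fun x => (Rf x)^-1) by exact: continuous_measurable_fun.
split.
- split; [exact: continuous_locally_integrable|exact: continuous_locally_integrable|].
  by rewrite RUE => phi; exact: transport.
- split; rewrite momE; last by move=> phi; exact: transport.
  by apply: continuous_locally_integrable; exact: affine_continuous.
- split; [exact: continuous_locally_integrable| |].
    rewrite fluxE; apply: continuous_locally_integrable; exact: affine_continuous.
  by rewrite fluxE => phi; exact: transport.
- by [].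
split.
- apply: continuous_locally_integrable; apply: continuous_for => x.
  exact: continuousM (@cV x) (@cS x).
- apply: open_integrable_locally; first exact: openT.
  apply: (le_integrable_off_point (x0 := x0) (g := fun x => Rm^-1 * `|derive1 S x|)).
  + exact: measurable_funM.
  + move=> x _; rewrite normrM ler_wpM2r// ger0_norm ?invr_ge0 ?(ltW (Rf0 x))//.
    by rewrite lef_pV2 ?posrE//; have /andP[] := RfR x.
  + by have := integrableZl measurableT Rm^-1 (integrable_norm intS).
- apply: open_integrable_locally; [exact: openT|exact: intU2].
move=> phi tphi.
have [smphi _] := tphi.
have mphi : measurable_fun setT phi.
  by apply: continuous_measurable_fun => x; apply: derivable1_continuous; exact: (smphi 0%N).
have mphi' : measurable_fun setT (derive1 phi).
  by apply: continuous_measurable_fun => x; apply: derivable1_continuous; exact: (smphi 1%N).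
have mRf' : measurable_fun setT (derive1 Rf).
  by apply: (@measurable_off_point _ x0) => x /eqP xx0; exact: (C1Rf x xx0).2.
have dS1 (r : R) : 0 < r -> {for r, continuous (derive1 (stress pt c m q k))}.
  by move=> r0; apply: (SP.1 r _).2; rewrite /= in_itv/= andbT.
have mSR : measurable_fun setT (fun x => derive1 (stress pt c m q k) (Rf x)).
  apply: continuous_measurable_fun; apply: continuous_for => x.
  exact: continuous_at_comp (@cRf x) (dS1 _ (Rf0 x)).
have mSm : measurable_fun setT S by exact: continuous_measurable_fun.
have dRf x : x != x0 -> is_derive x 1 Rf (derive1 Rf x).
  by move=> /eqP xx0; exact: is_derive_derive1 (C1Rf x xx0).1.
rewrite -[RHS](weq phi tphi).
apply: (@stress_balance_eq R x0 alpha m Rf (derive1 Rf) (derive1 U) S (derive1 S)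
  (fun x => derive1 (stress pt c m q k) (Rf x)) phi (derive1 phi) mV mRf' mU mSm mS mSR mphi mphi' Rfn0).
- move=> x xx0; apply: is_derive1_eq.
  have dV := is_deriveZ m (is_deriveV (Rfn0 x) (is_derive_id (Rf x) 1)).
  have dv : is_derive (Rf x) 1 (velocity c m) (- (m / Rf x ^+ 2)).
    apply: (is_derive_eq (is_deriveD (is_derive_cst c (Rf x) 1) dV)).
    by rewrite /GRing.scale/=; field; exact: Rfn0.
  exact: (@is_derive1_comp R (velocity c m) Rf x _ _ dv (dRf x xx0)).
- move=> x xx0; apply: is_derive1_eq.
  have dSr : is_derive (Rf x) 1 (stress pt c m q k) (derive1 (stress pt c m q k) (Rf x)).
    exact: is_derive_derive1 (SP.1 _ (P x)).1.
  exact: (@is_derive1_comp R (stress pt c m q k) Rf x _ _ dSr (dRf x xx0)).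
Qed.

Theorem theorem4p10 (R : realType)
  (alpha : R) (alpha_gt0 : 0 < alpha)
  (pt : R -> R -> R) (pt_C2 : C2_half_plane pt)
  (c m q k : R) (m_neq0 : m != 0)
  (Rm Rp Um Up Em Ep : R) (Rm_gt0 : 0 < Rm) (Rp_gt0 : 0 < Rp)
  (RHm : Rankine_Hugoniot pt c m q k Rm Um Em)
  (RHp : Rankine_Hugoniot pt c m q k Rp Up Ep)
  (Rm_lt_Rp : Rm < Rp)
  (dp_ge0_m : 0 <= derive1 (pressure pt c m q k) Rm)
  (dp_ge0_p : 0 <= derive1 (pressure pt c m q k) Rp)
  (Lax_m : c < Um - Num.sqrt (derive1 (pressure pt c m q k) Rm))
  (Lax_p : Up - Num.sqrt (derive1 (pressure pt c m q k) Rp) < c)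
  (p_C2 : C2_on `]0, +oo[ (pressure pt c m q k))
  (p_convex : (forall rho, Rm <= rho <= Rp -> convexity_A pt c m q k rho) \/
              (forall rho, Rm <= rho <= Rp -> convexity_B pt c m q k rho))
  (ddp_ge0 : forall rho, 0 < rho -> 0 <= derive1n 2 (pressure pt c m q k) rho)
  (Rs : R) (Rs_sonic : sonic_density pt c m q k Rm Rp Rs)
  (ddp_lipschitz : exists2 N, nbhs Rs N &
    [lipschitz derive1n 2 (pressure pt c m q k) x | x in N])
  (Zm Zp : R -> R)
  (Zm_canonical : canonical_left pt alpha c m q k Rm Rs Zm)
  (Zp_canonical : canonical_right pt alpha c m q k Rs Rp Zp)
  (xis : R) (Rf : R -> R)
  (Rf_profile : global_profile pt alpha c m q k Rm Rp Rs Zm Zp xis Rf) :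
  let a_s := sonic_exponent pt c m q k Rs in
  let U := fun x => velocity c m (Rf x) in
  let e := fun x => internal_energy c m q k (Rf x) in
  let S := fun x => stress pt c m q k (Rf x) in
  let E := fun x => total_energy c m q k (Rf x) in
  let Omega := `]-oo, xis[ `|` `]xis, +oo[ in
  (* (i) *)
  weak_solution pt alpha c Rf U E e S /\
  (* (ii) *)
  [/\ C2_on Omega Rf, C2_on Omega U, C2_on Omega E, C2_on Omega e
    & C2_on Omega S] /\
  (* (iii) *)
  (forall b : R,
    (0 < a_s < 2 /\ b = (1 + a_s / 2)^-1) \/ (a_s = 0 /\ 0 < b < 1) ->
    [/\ Holder_near b xis Rf, Holder_near b xis U, Holder_near b xis E,
        Holder_near b xis e & Holder_near b xis S]) /\
  (* (iv) *)
  [/\ in_Lp +oo Rf, in_Lp +oo U, in_Lp +oo E, in_Lp +oo e & in_Lp +oo S] /\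
  (forall Rint : R -> R, interpolant Rm Rp xis Rint ->
    forall mu : \bar R, (1 <= mu)%E ->
    [/\ in_Lp mu (fun x => Rf x - Rint x),
        in_Lp mu (fun x => U x - velocity c m (Rint x)),
        in_Lp mu (fun x => E x - total_energy c m q k (Rint x)),
        in_Lp mu (fun x => e x - internal_energy c m q k (Rint x)) &
        in_Lp mu (fun x => S x - stress pt c m q k (Rint x))]) /\
  (* (v) *)
  (forall r : R, admissible a_s r ->
    [/\ deriv_in_Lp r%:E Rf, deriv_in_Lp r%:E U, deriv_in_Lp r%:E E,
        deriv_in_Lp r%:E e & deriv_in_Lp r%:E S]) /\
  (* (vi) *)
  (forall Rint : R -> R, interpolant Rm Rp xis Rint ->
    forall r : R, admissible a_s r ->
    [/\ in_W1p r%:E (fun x => Rf x - Rint x),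
        in_W1p r%:E (fun x => U x - velocity c m (Rint x)),
        in_W1p r%:E (fun x => E x - total_energy c m q k (Rint x)),
        in_W1p r%:E (fun x => e x - internal_energy c m q k (Rint x)) &
        in_W1p r%:E (fun x => S x - stress pt c m q k (Rint x))]).
Proof.
move=> a_s U e S E Omega.
have SRm := stress_Rankine_Hugoniot Rm_gt0 m_neq0 RHm.
have SRp := stress_Rankine_Hugoniot Rp_gt0 m_neq0 RHp.
have SP := stress_C2 p_C2.
have Rs0 : 0 < Rs by case: Rs_sonic => /andP[+ _] _ _; exact: lt_trans.
have [as0 as2 _] := sonic_exponent_bounds m_neq0 Rs0 p_C2 (ddp_ge0 Rs Rs0).
rewrite -/a_s in as0 as2.
have bounds (a : R) (a0 : 0 < a) (aE : a_s <= a) :=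
  profile_bounds alpha_gt0 m_neq0 Rm_gt0 Rp_gt0 SRm SRp p_C2 ddp_ge0 Rs_sonic
    ddp_lipschitz Zm_canonical Zp_canonical Rf_profile a0 aE.
have [[Rf_in cRf Rf_incr Rf_xis] [C2Rf _ _] _ _ Rf_weq] := Rf_profile.
rewrite Omega_setC1 in C2Rf; have C1Rf := C2Rf.1.
have RfR x : Rm <= Rf x <= Rp by have /andP[/ltW -> /ltW ->] := Rf_in x.
have Rf_neq x : x != xis -> Rf x != Rs.
  rewrite -Rf_xis neq_lt => /orP[] /Rf_incr xx; first by rewrite lt_eqF.
  by rewrite gt_eqF.
have Rf'0 := increasing_derive1_ge0 C1Rf Rf_incr.
have dRf x : x != xis -> is_derive x 1 Rf (derive1 Rf x).
  by move=> /eqP xx0; exact: is_derive_derive1 (C1Rf x xx0).1.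
have cRf' x : x != xis -> {for x, continuous (derive1 Rf)}.
  by move=> /eqP xx0; exact: (C1Rf x xx0).2.
have Rf_dist x : `|Rf x - Rs| <= Rp - Rm.
  have /andP[RmRf RfRp] := RfR x; have [/andP[RmRs RsRp] _ _] := Rs_sonic.
  by rewrite ler_norml; apply/andP; split; lra.
have exponent (r : R) : 1 <= r -> admissible a_s r ->
    exists a : R, [/\ 0 < a, a_s <= a & a / 2 * (r - 1) < 1].
  move=> r1 [[/andP[a0 _] /andP[_ rlt]]|[a0 _]].
    exists a_s; split => //.
    have r1lt : r - 1 < 2 / a_s by rewrite ltrBlDl.
    rewrite -(ltr_pM2l (_ : 0 < 2 / a_s)) ?divr_gt0// mulr1 mulrA.
    by rewrite (_ : 2 / a_s * (a_s / 2) = 1) ?mul1r//; field; rewrite gt_eqF.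
  (* For [a_s = 0] any positive [a] with [a (r - 1) < 2] will do; [a = 1 / r] gives
     [a / 2 * (r - 1) = (r - 1) / (2 r) < 1]. *)
  have r0 : 0 < r by exact: lt_le_trans r1.
  exists r^-1; rewrite a0 invr_gt0 invr_ge0 (ltW r0); split => //.
  rewrite -(ltr_pM2l (_ : 0 < 2 * r)) ?mulr_gt0// mulr1.
  rewrite (_ : 2 * r * (r^-1 / 2 * (r - 1)) = r - 1); last by field; rewrite gt_eqF.
  lra.
have intr (r : R) : 1 <= r -> admissible a_s r ->
    (@lebesgue_measure R).-integrable setT (fun x => (`|derive1 Rf x| `^ r)%:E).
  move=> r1 /(exponent r r1)[a [a0 aE ar]].
  have [_ [K RfK]] := bounds a a0 aE.
  exact: (integrable_derive1_powR cRf C1Rf Rf_neq Rf'0 Rf_dist RfK r1 ar).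
(* From [a_s < 2] one gets [1 + 2 / a_s > 2], so the exponents [1] and [2] are always available. *)
have adm_lt2 (r : R) : 1 <= r -> r <= 2 -> admissible a_s r.
  move=> r1 r2; have [a0|a0|a0] := ltgtP a_s 0; [by move: as0; rewrite leNgt a0|left|by right].
  rewrite a0 as2 r1; split => //; apply: le_lt_trans r2 _.
  have : 1 < 2 / a_s by rewrite ltr_pdivlMr// mul1r.
  lra.
have adm1 : admissible a_s 1 by apply: adm_lt2; rewrite ?ler1n.
have adm2 : admissible a_s 2 by apply: adm_lt2; rewrite ?ler1n.
have intv v : interpolant Rm Rp xis v ->
    (@lebesgue_measure R).-integrable setT (EFin \o (fun x => Rf x - v x)).
  move=> hv; have [_ dv _ _] := interpolant_derivative hv.
  have cv : continuous v by move=> x; exact: is_derive1_continuous (dv x).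
  (* Any positive exponent at least [a_s] serves here: only the comparison of [Rdot] with the
     distance to the end state is extracted. *)
  have a1 : 0 < Num.max a_s 1 by rewrite lt_max ltr01 orbT.
  have aa : a_s <= Num.max a_s 1 by rewrite le_max lexx.
  have [[K K0 RfK] _] := bounds _ a1 aa.
  apply: (sub_interpolant_integrable cRf cv RfR hv K0 RfK).
  apply: integrable_powR1; first exact: intr.
  exact: measurable_off_point cRf'.
have reg g (gP : C2_on `]0, +oo[ g) :=
  composition_regularity Rm_gt0 RfR cRf dRf cRf' intr adm1 intv gP.
have C2_comp g : C2_on `]0, +oo[ g -> C2_on Omega (fun x => g (Rf x)).
  move=> gP; rewrite /Omega Omega_setC1; apply: (C2_on_comp (@open_setC1 R xis) (@open_pos R) gP C2Rf).
  move=> x _; rewrite /= in_itv/= andbT; have /andP[+ _] := RfR x; exact: lt_le_trans.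
have idP := C2_on_id (@open_pos R).
have vP := velocity_C2 c m.
have iP := internal_energy_C2 c m q k.
have tP := total_energy_C2 c m q k.
have [h_id oo_id sub_id d_id W_id] := reg _ idP.
have [h_U oo_U sub_U d_U W_U] := reg _ vP.
have [h_e oo_e sub_e d_e W_e] := reg _ iP.
have [h_E oo_E sub_E d_E W_E] := reg _ tP.
have [h_S oo_S sub_S d_S W_S] := reg _ SP.
split.
  exact: (weak_solution_of_profile m_neq0 Rm_gt0 RfR cRf C1Rf SP (d_U 1 adm1) (d_U 2 adm2) (d_S 1 adm1) Rf_weq).
split.
  split; [by rewrite /Omega Omega_setC1|exact: C2_comp vP|exact: C2_comp tP|exact: C2_comp iP|exact: C2_comp SP].
split.
  move=> b hb.
  have [C RfC] : exists C : R, forall x y, `|Rf x - Rf y| <= C * `|x - y| `^ b.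
    have [a [a0 aE ->]] : exists a : R, [/\ 0 < a, a_s <= a & b = (1 + a / 2)^-1].
      case: hb => [[/andP[a0 _] ->]|[a0 /andP[b0 b1]]]; first by exists a_s.
      (* The solution [a] of [b = 1 / (1 + a / 2)], positive because [b < 1]. *)
      have a_gt0 : 0 < 2 * (b^-1 - 1) by rewrite mulr_gt0// subr_gt0 invf_gt1.
      exists (2 * (b^-1 - 1)); rewrite a0; split => //; first exact: ltW.
      rewrite (_ : 1 + _ = b^-1) ?invrK//; field; by rewrite gt_eqF.
    have [_ [K RfK]] := bounds a a0 aE.
    exact: (holder_of_weighted_derivative cRf C1Rf Rf_neq Rf'0 a0 RfK).
  by split; [exact: h_id RfC|exact: h_U RfC|exact: h_E RfC|exact: h_e RfC|exact: h_S RfC].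
split; first by split; [exact: oo_id|exact: oo_U|exact: oo_E|exact: oo_e|exact: oo_S].
split.
  move=> v hv p p1.
  by split; [exact: sub_id|exact: sub_U|exact: sub_E|exact: sub_e|exact: sub_S].
split.
  by move=> r hr; split; [exact: d_id|exact: d_U|exact: d_E|exact: d_e|exact: d_S].
move=> v hv r hr.
by split; [exact: W_id|exact: W_U|exact: W_E|exact: W_e|exact: W_S].
Qed.
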